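(* Let $\xi,\xi_1,\xi_2,\ldots$ be independent identically distributed real random variables with finite mean and common distribution $F\in\mathcal S^*$, and let $\tau$ be a counting random variable with ${\bf E}\tau<\infty$ which is independent of the sequence $\{\xi_n\}$. (i) If ${\bf E}\xi<0$, then $$ {\bf P}\{S_\tau>x\}\sim{\bf P}\{M_\tau>x\}\sim{\bf E}\tau\,\overline F(x)\quad\text{as }x\to\infty. \qquad ( * ) $$ (ii) If ${\bf E}\xi\ge 0$ and if there exists $c>{\bf E}\xi$ such that ${\bf P}\{c\tau>x\}=o(\overline F(x))$ as $x\to\infty$, then the asymptotics $( * )$ again hold.
   Context: $\overline F(x)={\bf P}\{\xi>x\}$, and $F$ is right-unbounded: $\overline F(x)>0$ for all $x$. $S_0=0$, $S_n=\xi_1+\cdots+\xi_n$, $M_n=\max_{0\le i\le n}S_i$. A counting random variable is a random variable with values in $\{0,1,2,\ldots\}$; $S_\tau$ and $M_\tau$ are $S_n$ and $M_n$ evaluated at the random index $n=\tau$. A distribution $F$ on ${\bf R}$ with finite mean (and $\overline F(x)>0$ for all $x$) belongs to the class $\mathcal S^*$ if $\int_0^x\overline F(x-y)\overline F(y)\,dy\sim 2a\,\overline F(x)$ as $x\to\infty$, where $a=\int_0^\infty\overline F(y)\,dy$. The chain $( * )$ means that ${\bf P}\{S_\tau>x\}/\overline F(x)\to{\bf E}\tau$ and ${\bf P}\{M_\tau>x\}/\overline F(x)\to{\bf E}\tau$ as $x\to\infty$. *)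

(* Defs.v *)
From HB Require Import structures.
From mathcomp Require Import all_boot all_order all_algebra finmap.
From mathcomp Require Import all_classical all_reals all_analysis.

Set Implicit Arguments.
Unset Strict Implicit.
Unset Printing Implicit Defensive.

Import Order.TTheory GRing.Theory Num.Theory.
Import numFieldNormedType.Exports.

Local Open Scope classical_set_scope.
Local Open Scope ring_scope.

(* The Landau notations need a canonical filter structure on the neighbourhoods
   of [+oo]; the library does not declare one. *)
Canonical pinfty_nbhs_filter_on (R : realType) :=
  FilterType (pinfty_nbhs R) (@filter_filter _ _ proper_pinfty_nbhs).

Definition tail {R : realType} (F : set R -> \bar R) (x : R) : R :=
  fine (F `]x, +oo[%classic).

Definition right_unbounded {R : realType} (F : set R -> \bar R) : Prop :=
  forall x : R, 0 < tail F x.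

Definition finite_mean {R : realType} (F : probability R R) : Prop :=
  F.-integrable [set: R] (fun x : R => x%:E).

(* Both integrals are real-valued ([Rintegral]); no value is lost, since the
   first integrand is bounded on a bounded interval and the second integral is
   finite under [finite_mean]. *)
Definition class_Sstar {R : realType} (F : probability R R) : Prop :=
  let mu := @lebesgue_measure R in
  let Fbar := tail F in
  let a := \int[mu]_(y in `[0, +oo[%classic) Fbar y in
  [/\ finite_mean F,
      right_unbounded F &
      (fun x : R => \int[mu]_(y in `[0, x]%classic) (Fbar (x - y) * Fbar y))
        ~_ (pinfty_nbhs R) (fun x : R => 2 * a * Fbar x)].

Section random_variables.
Context d {T : measurableType d} {R : realType} (P : probability T R).

Definition identically_distributed (X Y : {RV P >-> R}) : Prop :=
  forall B : set R, measurable B -> distribution P X B = distribution P Y B.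

Definition mutually_independent (X : nat -> {RV P >-> R}) : Prop :=
  forall (J : {fset nat}) (B : nat -> set R),
    (forall i, i \in J -> measurable (B i)) ->
    P (\bigcap_(i in [set` J]) (X i @^-1` B i)) =
    (\prod_(i <- J) P (X i @^-1` B i))%E.

Definition sigma_of_sequence (X : nat -> {RV P >-> R}) : set (set T) :=
  <<s \bigcup_n preimage_set_system [set: T] (X n) measurable >>.

Definition independent_of_sequence (tau : {RV P >-> nat})
    (X : nat -> {RV P >-> R}) : Prop :=
  forall (A : set T) (B : set nat), sigma_of_sequence X A ->
    P (A `&` tau @^-1` B) = (P A * P (tau @^-1` B))%E.

End random_variables.
Arguments identically_distributed {d T R} P X Y.
Arguments mutually_independent {d T R} P X.
Arguments independent_of_sequence {d T R} P tau X.

Section random_walk.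
Context {T : Type} {R : realType}.

(* The summands are numbered from 0: [xi i] is the (i+1)-st one. *)
Definition partial_sum (xi : nat -> T -> R) (n : nat) (w : T) : R :=
  \sum_(i < n) xi i w.

Definition partial_max (xi : nat -> T -> R) (n : nat) (w : T) : R :=
  \big[Num.max/partial_sum xi 0 w]_(i < n.+1) partial_sum xi i w.

Definition at_random_index (Y : nat -> T -> R) (tau : T -> nat) (w : T) : R :=
  Y (tau w) w.

End random_walk.

(* Stated for a ratio, so that a zero constant [C] means
   [P {Y > x} = o (Fbar x)]. *)
Definition tail_ratio_cvg d {T : measurableType d} {R : realType}
    (P : probability T R) (Y : T -> R) (Fbar : R -> R) (C : R) : Prop :=
  fine (P [set w | x < Y w]) / Fbar x @[x --> +oo] --> C.

Definition random_sum_tail_asymptotics d {T : measurableType d} {R : realType}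
    (P : probability T R) (xi : {RV P >-> R}) (xis : nat -> {RV P >-> R})
    (tau : {RV P >-> nat}) : Prop :=
  let Fbar := tail (distribution P xi) in
  let Etau := fine 'E_P[fun w => (tau w)%:R] in
  tail_ratio_cvg P (at_random_index (partial_sum xis) tau) Fbar Etau /\
  tail_ratio_cvg P (at_random_index (partial_max xis) tau) Fbar Etau.
Arguments random_sum_tail_asymptotics {d T R} P xi xis tau.

(* Main.v *)
Require Import Defs.
From HB Require Import structures.
From mathcomp Require Import all_boot all_order all_algebra finmap.
From mathcomp Require Import all_classical all_reals all_analysis.
From mathcomp Require Import measurable_realfun ring lra.

Set Implicit Arguments.
Unset Strict Implicit.
Unset Printing Implicit Defensive.

Import Order.TTheory GRing.Theory Num.Theory.
Import numFieldNormedType.Exports.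

Local Open Scope classical_set_scope.
Local Open Scope ring_scope.

(** Write [Fb] for the tail of the increments and [M n] for the maximum of the
    first [n] partial sums.

    For a fixed [n] both [P (S n > x)] and [P (M n > x)] are equivalent to
    [n * Fb x]: one summand makes the whole jump. The lower bound
    ([sum_tail_lower]) needs a long tail, the upper bound ([max_tail_upper]) that
    two large jumps are too expensive. Since the index is independent of the walk,
    the claim is then an interchange of a limit and a sum over the values of the
    index ([random_index_liminf], [random_index_limsup]). From below this is
    Fatou's lemma, applied to the sums; as sums are below maxima, what is left is a
    domination, from above, for the maxima.

    The domination rests on one estimate ([max_tail_uniform]): if the mean of the
    increments is below [c >= 0], the walk with increments lowered by [c] exceeds
    [x] within [n] steps with probability at most [K] times the integral of [Fb]
    over the window [x, x + L * n], uniformly in [n] and [x]. The probability is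
    followed by recursion on [n], and the window is shown to be a supersolution: on
    average one step changes the window by at most the convolution of [Fb] with
    itself, restricted to jumps below [x], minus what the downward steps gain. The
    definition of the class makes this convolution at most about [a * Fb x], with
    [a] the mean of the positive part ([mean_overlap_below]), so that the two add up
    to about the drift times [Fb x], which is negative.

    With a negative mean, [c = 0] gives [P (M n > x) <= K * L * n * Fb x], and the
    index has a finite mean ([late_maxima_neg_drift]). Otherwise the lowered walk
    must exceed [x - c * n]; for [c * n <= x] the window bound at this level,
    summed over [n] against the law of the index, is the convolution of [Fb] with
    the tail of [c * tau]. The latter is negligible with respect to [Fb], hence so
    is this convolution with respect to that of [Fb] with itself, which has the
    order of [Fb] ([late_maxima_light_index]).

    The integral of [Fb] over [0, x] is the mean of the increment truncated to
    [0, x] ([itail]), and the convolution of [Fb] with itself is the mean of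
    [overlap F x]; after these two identifications all estimates are means of
    pointwise inequalities. *)

(** * Real expectations *)

Section real_expectation.
Context d {T : measurableType d} {R : realType} (P : probability T R).
Implicit Types (f g h k : T -> R) (b : T -> bool).

Definition integrableR f := P.-integrable [set: T] (EFin \o f).

Definition mean f : R := \int[P]_t f t.

Lemma integrableR_measurable f : integrableR f -> measurable_fun [set: T] f.
Proof. by move=> /integrableP[/measurable_EFinP]. Qed.

Lemma integrableR_dom f g : measurable_fun [set: T] f ->
  (forall t, `|f t| <= g t) -> integrableR g -> integrableR f.
Proof.
move=> mf fg ig; apply: le_integrable ig => //; first exact/measurable_EFinP.
by move=> t _ /=; rewrite lee_fin (le_trans (fg t))// ler_norm.
Qed.

Lemma integrableR_cst (r : R) : integrableR (fun=> r).
Proof. exact: finite_measure_integrable_cst. Qed.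

Lemma integrableR_bounded f (C : R) : measurable_fun [set: T] f ->
  (forall t, `|f t| <= C) -> integrableR f.
Proof. by move=> mf fC; exact: integrableR_dom mf fC (integrableR_cst C). Qed.

Lemma integrableRD f g : integrableR f -> integrableR g ->
  integrableR (fun t => f t + g t).
Proof. by move=> fi gi; exact: (integrableD measurableT fi gi). Qed.

Lemma integrableRZ (r : R) f : integrableR f -> integrableR (fun t => r * f t).
Proof. by move=> fi; exact: (integrableZl measurableT r fi). Qed.

Lemma integrableRN f : integrableR f -> integrableR (fun t => - f t).
Proof. by move=> fi; exact: (integrableN fi). Qed.

Lemma integrableRB f g : integrableR f -> integrableR g ->
  integrableR (fun t => f t - g t).
Proof. by move=> fi gi; apply/integrableRD/integrableRN. Qed.

Lemma integrableR_if b f g : measurable_fun [set: T] b ->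
  integrableR f -> integrableR g ->
  integrableR (fun t => if b t then f t else g t).
Proof.
move=> mb fi gi.
apply: (@integrableR_dom _ (fun t => `|f t| + `|g t|)).
- by apply: measurable_fun_ifT => //; exact: integrableR_measurable.
- by move=> t; case: ifP => _; rewrite ?lerDl ?lerDr.
- by apply: integrableRD; exact: integrable_norm.
Qed.

Lemma integrableR_norm f : integrableR f -> integrableR (fun t => `|f t|).
Proof. exact: integrable_norm. Qed.

Lemma measurable_fun_normr f : measurable_fun [set: T] f ->
  measurable_fun [set: T] (fun t => `|f t|).
Proof. by move=> mf; exact: measurableT_comp. Qed.

Lemma integrableR_max f g : integrableR f -> integrableR g ->
  integrableR (fun t => Num.max (f t) (g t)).
Proof.
move=> fi gi; apply: integrableR_if => //.
by apply: measurable_fun_ltr; exact: integrableR_measurable.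
Qed.

Lemma integrableR_min f g : integrableR f -> integrableR g ->
  integrableR (fun t => Num.min (f t) (g t)).
Proof.
move=> fi gi; apply: integrableR_if => //.
by apply: measurable_fun_ltr; exact: integrableR_measurable.
Qed.

Lemma mean_cst (r : R) : mean (fun=> r) = r.
Proof.
rewrite /mean Rintegral_cst//.
by move: (probability_setT P) => /= ->; rewrite mulr1.
Qed.

Lemma meanD f g : integrableR f -> integrableR g ->
  mean (fun t => f t + g t) = mean f + mean g.
Proof. by move=> fi gi; rewrite /mean RintegralD. Qed.

Lemma meanB f g : integrableR f -> integrableR g ->
  mean (fun t => f t - g t) = mean f - mean g.
Proof. by move=> fi gi; rewrite /mean RintegralB. Qed.

Lemma meanZ (r : R) f : integrableR f -> mean (fun t => r * f t) = r * mean f.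
Proof. by move=> fi; rewrite /mean RintegralZl. Qed.

Lemma le_mean f g : integrableR f -> integrableR g ->
  (forall t, f t <= g t) -> mean f <= mean g.
Proof. by move=> fi gi fg; apply: le_Rintegral. Qed.

Lemma le_meanB f g h k : integrableR f -> integrableR g ->
  integrableR h -> integrableR k -> (forall t, f t - g t <= h t - k t) ->
  mean f - mean g <= mean h - mean k.
Proof.
move=> fi gi hi ki fghk; rewrite -(meanB fi gi) -(meanB hi ki).
by apply: le_mean => //; exact: integrableRB.
Qed.

Lemma eq_mean f g : f =1 g -> mean f = mean g.
Proof. by move=> fg; apply: eq_Rintegral => t _. Qed.

Lemma mean_ge0 f : (forall t, 0 <= f t) -> 0 <= mean f.
Proof. by move=> f0; apply: Rintegral_ge0. Qed.

Lemma EFin_mean f : integrableR f -> (mean f)%:E = (\int[P]_t (f t)%:E)%E.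
Proof. by move=> fi; rewrite /mean /Rintegral fineK// integrable_fin_num. Qed.

Lemma mean_if b : measurable_fun [set: T] b ->
  mean (fun t => if b t then 1 else 0) = fine (P [set t | b t]).
Proof.
move=> mb; have mB : measurable [set t | b t].
  by rewrite -[X in measurable X]setTI; apply: (mb _ [set true]).
rewrite /mean /Rintegral; congr fine.
transitivity (\int[P]_t (\1_[set t | b t] t)%:E)%E; last first.
  by rewrite integral_indic// setIT.
apply: eq_integral => t _; rewrite indicE.
by case: ifPn => bt; [rewrite mem_set|rewrite memNset//; exact/negP].
Qed.

Lemma le_probability (A B : set T) : measurable A -> measurable B ->
  A `<=` B -> fine (P A) <= fine (P B).
Proof.
by move=> mA mB AB; rewrite fine_le ?fin_num_measure// le_measure// inE.
Qed.

Lemma measurable_lt_event f (x : R) : measurable_fun [set: T] f ->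
  measurable [set t | x < f t].
Proof.
move=> mf; rewrite -[X in measurable X]setTI.
have mb : measurable_fun [set: T] (fun t => x < f t).
  by apply: measurable_fun_ltr => //; exact: measurable_cst.
exact: (mb measurableT [set true]).
Qed.

Lemma mean_sum n (F : nat -> T -> R) : (forall i, integrableR (F i)) ->
  integrableR (fun t => \sum_(i < n) F i t) /\
  mean (fun t => \sum_(i < n) F i t) = \sum_(i < n) mean (F i).
Proof.
move=> Fi; elim: n => [|n [ih1 ih2]].
  split; first by under eq_fun do rewrite big_ord0; exact: integrableR_cst.
  by under eq_mean do rewrite big_ord0; rewrite mean_cst big_ord0.
split.
  by under eq_fun do rewrite big_ord_recr/=; exact: integrableRD.
under eq_mean do rewrite big_ord_recr/=.
by rewrite meanD// ih2 big_ord_recr.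
Qed.

(** A single integrable function is uniformly integrable: dominated convergence
    along integer levels. Every truncation error below is bounded by this. *)
Lemma mean_above_small f e : integrableR f -> 0 < e ->
  exists2 B : R, 0 <= B &
    mean (fun t => if B < `|f t| then `|f t| else 0) <= e.
Proof.
move=> fi e0.
have mf := integrableR_measurable fi.
have nfi : integrableR (fun t => `|f t|) by exact: integrable_norm.
pose u n t : R := if n%:R < `|f t| then `|f t| else 0.
have ui n : integrableR (u n).
  apply: integrableR_if => //; last exact: integrableR_cst.
  by apply: measurable_fun_ltr => //; exact: integrableR_measurable.
have [] := @dominated_convergence _ T R P setT measurableT
  (fun n => EFin \o u n) (cst 0%E) (fun t => `|f t|%:E).
- by move=> n; exact/measurable_EFinP/(integrableR_measurable (ui n)).
- exact: measurable_cst.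
- apply: aeW => t _ /=; apply: cvg_near_cst.
  exists (Num.truncn `|f t|).+1 => // n /= tn.
  rewrite /u ifF//; apply/negbTE; rewrite -leNgt.
  apply: (le_trans (ltW (truncnS_gt _))).
  by rewrite ler_nat.
- exact: nfi.
- apply: aeW => t n _ /=; rewrite lee_fin /u; case: ifP => _.
    by rewrite normr_id.
  by rewrite normr0.
move=> _ _; rewrite integral_cst// mul0e => uc.
have /fine_cvgP[_ /cvgrPdist_le/(_ _ e0)[N _ /(_ N (leqnn N))]] := uc.
rewrite /= sub0r normrN => uN; exists N%:R => //.
exact: le_trans (ler_norm _) uN.
Qed.

End real_expectation.

Arguments integrableR {d T R} P f.
Arguments mean {d T R} P f.

Ltac measurable_step :=
  first [ assumption | exact: measurable_cst | exact: measurable_id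
        | apply: measurable_fun_ltr | apply: measurable_fun_ler
        | apply: measurable_maxr | apply: measurable_minr
        | apply: measurable_fun_normr | apply: measurable_funD | apply: measurable_funN
        | apply: measurable_funM
        | apply: integrableR_measurable; eassumption ].

Ltac integrable_step :=
  first [ eassumption | exact: integrableR_cst | apply: integrableRD
        | apply: integrableRN | apply: integrableRZ
        | apply: integrableR_max | apply: integrableR_min
        | apply: integrableR_norm | apply: integrableR_if ].

(** The closure properties above, applied along the syntax of an explicit
    expression. *)
Ltac integrability := repeat (first [integrable_step | measurable_step]).

Ltac no_if t := lazymatch t with context [if _ then _ else _] => fail | _ => idtac end.

(** Splits on all comparisons that a piecewise expression is built from,
    innermost first, then calls linear arithmetic. *)
Ltac split_cases :=
  rewrite ?/Order.min ?/Order.max;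
  repeat match goal with
  | |- context [if @Order.lt _ _ ?a ?b then _ else _] =>
      no_if a; no_if b; case: (ltP a b) => ?
  | |- context [if @Order.le _ _ ?a ?b then _ else _] =>
      no_if a; no_if b; case: (leP a b) => ?
  end.

Ltac piecewise := split_cases; lra.

(** * The integrated tail *)

Section integrated_tail.
Context {R : realType} (F : probability R R).
Implicit Types (x y z s t h e B : R).

Notation Ex := (mean F).
Notation Fb := (tail F).

Lemma tailE x : Fb x = Ex (fun y => if x < y then 1 else 0).
Proof.
rewrite mean_if; last by integrability.
by rewrite /tail; congr (fine (F _)); apply/seteqP; split=> y /=; rewrite in_itv/= andbT.
Qed.

Lemma tail_ge0 x : 0 <= Fb x. Proof. by rewrite fine_ge0. Qed.

Lemma tail_le1 x : Fb x <= 1.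
Proof.
rewrite tailE -[leRHS](mean_cst F); apply: le_mean; integrability => y.
by case: ifP.
Qed.

Lemma tail_nonincreasing x y : x <= y -> Fb y <= Fb x.
Proof.
move=> xy; rewrite !tailE; apply: le_mean; integrability => t.
by case: ifP => [/(le_lt_trans xy) ->//|_]; case: ifP.
Qed.

Hypothesis Fi : integrableR F (fun y => y).

Definition pos_mean := Ex (fun y => Num.max y 0).

(** For [0 <= t] this is the integral of the tail over [0, t]; as a mean of
    piecewise linear functions of [y] it inherits their inequalities. *)
Definition itail t := Ex (fun y => Num.min (Num.max y 0) t).

Lemma itail_le s t : s <= t -> itail s <= itail t.
Proof.
move=> st; apply: le_mean; integrability => y.
by piecewise.
Qed.

Lemma itail_diff_ge s t : s <= t -> (t - s) * Fb t <= itail t - itail s.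
Proof.
move=> st; rewrite tailE -meanZ; last by integrability.
rewrite -meanB; [|integrability|integrability].
apply: le_mean; integrability => y.
by piecewise.
Qed.

Lemma itail_diff_le s t : 0 <= s -> s <= t ->
  itail t - itail s <= (t - s) * Fb s.
Proof.
move=> s0 st; rewrite tailE -meanZ; last by integrability.
rewrite -meanB; [|integrability|integrability].
apply: le_mean; integrability => y.
by piecewise.
Qed.

Lemma itail_concave s t h : s <= t -> 0 <= h ->
  itail (t + h) - itail t <= itail (s + h) - itail s.
Proof.
move=> st h0; apply: le_meanB; integrability => y.
by piecewise.
Qed.

(** Concavity in [h]: a longer window is dominated by a multiple of a shorter
    one with the same left end. *)
Lemma itail_star z h h' : 0 < h -> h <= h' ->
  itail (z + h') - itail z <= h' / h * (itail (z + h) - itail z).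
Proof.
move=> h0 hh'; rewrite mulrBr -!meanZ; integrability.
apply: le_meanB; integrability => y.
have k1 : 1 <= h' / h by rewrite ler_pdivlMr// mul1r.
set k := h' / h in k1 *.
have kh : k * h = h' by rewrite /k divfK ?gt_eqF.
by split_cases; nra.
Qed.

Lemma itail0 : itail 0 = 0.
Proof.
rewrite -[RHS](mean_cst F); apply: eq_mean => y.
by piecewise.
Qed.

Lemma itail_ge0 t : 0 <= t -> 0 <= itail t.
Proof. by move=> t0; rewrite -itail0 itail_le. Qed.

Lemma itail_le_pos_mean t : itail t <= pos_mean.
Proof.
apply: le_mean; integrability => y.
by piecewise.
Qed.

Lemma measurable_itail : measurable_fun [set: R] itail.
Proof. by apply: nondecreasing_measurable => // s t; exact: itail_le. Qed.

Lemma itail_near_pos_mean e : 0 < e ->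
  exists2 B : R, 0 <= B & forall x, B <= x -> pos_mean - e <= itail x.
Proof.
move=> e0; have [B B0 Be] := mean_above_small Fi e0; exists B => // x Bx.
rewrite lerBlDl -lerBlDr (le_trans _ Be)// -meanB; integrability.
apply: le_mean; integrability => y; have := ler_norm y; have := normr_ge0 y.
by piecewise.
Qed.

End integrated_tail.

(** * The defining convolution as an expectation *)

Section tail_convolution.
Context {R : realType} (F : probability R R).
Implicit Types (x y z s t h e B : R).

Notation Ex := (mean F).
Notation Fb := (tail F).
Notation mu := (@lebesgue_measure R).
Let GR := measurableTypeR R.

Hypothesis Fi : integrableR F (fun y => y).

(** For [0 <= x] this is the integral of [tail F (x - s) * 1(s < y)] over
    [0, x], the contribution of a jump [y] to the convolution of the tail with
    itself. *)
Definition overlap x y := itail F x - itail F (Num.max (x - Num.max y 0) 0).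

Lemma measurable_tail : measurable_fun [set: R] Fb.
Proof.
by apply: nonincreasing_measurable => // s t; exact: tail_nonincreasing.
Qed.

(** The tail at [s] is the mass of the [y] beyond [s], so exchanging the two
    integrations leaves the length of the part of [m, x] below [y]. *)
Lemma integral_tail_itv m x : 0 <= m -> m <= x ->
  (\int[mu]_s (if m < s then if s <= x then Fb s else 0 else 0)%:E)%E
  = (itail F x - itail F m)%:E.
Proof.
move=> m0 mx.
pose phi (p : GR * R) : R :=
  if m < p.1 then if p.1 <= x then if p.1 < p.2 then 1 else 0 else 0 else 0.
have mphi : measurable_fun [set: GR * R] phi.
  have m1 : measurable_fun [set: GR * R] (fun p : GR * R => p.1) by exact: measurable_fst.
  have m2 : measurable_fun [set: GR * R] (fun p : GR * R => p.2) by exact: measurable_snd.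
  by do 3! (apply: measurable_fun_ifT => //; first by integrability).
have phi0 p : 0 <= phi p by rewrite /phi; piecewise.
transitivity (\int[mu]_s \int[F]_y (phi (s, y))%:E)%E.
  apply: eq_integral => s _; rewrite /phi/=.
  case: ifP => _; last by rewrite integral0.
  case: ifP => _; last by rewrite integral0.
  by rewrite tailE EFin_mean//; integrability.
transitivity (\int[F]_y \int[mu]_s (phi (s, y))%:E)%E.
  apply: (fubini_tonelli (EFin \o phi)); first exact/measurable_EFinP.
  by move=> p; rewrite lee_fin.
rewrite -meanB; [|integrability|integrability].
rewrite EFin_mean; last by integrability.
apply: eq_integral => y _.
transitivity (\int[mu]_s (\1_([set` if y <= x then `]m, y[ else `]m, x]]) s)%:E)%E.
  suff phiE (s : R) :
      phi (s, y) = \1_([set` if y <= x then `]m, y[ else `]m, x]]) s.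
    by apply: eq_integral => s _; rewrite -phiE.
  rewrite indicE /phi/=; case: (leP y x) => yx; rewrite mem_setE in_itv/=;
    by case: (ltP m s) => ms //=; case: (leP s x) => sx //=;
       case: (ltP s y) => sy //=; lra.
rewrite integral_indic// setIT.
case: (leP y x) => yx; rewrite /= lebesgue_measure_itv/= lte_fin;
  case: ifPn => ?; rewrite -?EFinB; congr EFin; piecewise.
Qed.

Lemma integrable_overlap x : 0 <= x -> integrableR F (overlap x).
Proof.
move=> x0; apply: (@integrableR_bounded _ _ _ _ _ (itail F x)).
  apply: measurable_funD; first exact: measurable_cst.
  apply: measurable_funN; apply: measurableT_comp.
    exact: measurable_itail.
  by apply: measurable_maxr; integrability.
move=> y; rewrite /overlap ger0_norm.
  by rewrite gerBl itail_ge0// le_max lexx orbT.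
by rewrite subr_ge0 itail_le//; piecewise.
Qed.

(** Writing [tail F (x - s)] as the mass of the [y] with [x - y < s] and
    exchanging the integrations. This turns the condition defining the class into
    one on the mean of a bounded function of a single jump. *)
Lemma integral_tail_convolution x : 0 <= x ->
  (\int[mu]_(s in `[0%R, x]) (Fb (x - s) * Fb s)%:E)%E = (Ex (overlap x))%:E.
Proof.
move=> x0.
pose phi (p : GR * R) : R :=
  if 0 < p.1 then if p.1 <= x then if x - p.1 < p.2 then Fb p.1 else 0 else 0
  else 0.
have mphi : measurable_fun [set: GR * R] phi.
  have m1 : measurable_fun [set: GR * R] (fun p : GR * R => p.1).
    exact: measurable_fst.
  have m2 : measurable_fun [set: GR * R] (fun p : GR * R => p.2).
    exact: measurable_snd.
  have m3 : measurable_fun [set: GR * R] (fun p : GR * R => Fb p.1).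
    exact: measurableT_comp measurable_tail m1.
  by do 3! (apply: measurable_fun_ifT => //; first by integrability).
have phi0 p : 0 <= phi p by rewrite /phi; have := tail_ge0 F p.1; piecewise.
have mconv : measurable_fun [set: R] (fun s => Fb (x - s) * Fb s).
  apply: measurable_funM; last exact: measurable_tail.
  by apply: measurableT_comp; [exact: measurable_tail|integrability].
rewrite -integral_itv_obnd_cbnd; last first.
  by apply/measurable_funTS/measurable_EFinP.
rewrite integral_mkcond.
transitivity (\int[mu]_s \int[F]_y (phi (s, y))%:E)%E.
  apply: eq_integral => s _; rewrite patchE mem_setE in_itv/= if_and /phi/=.
  case: ifP => _; last by rewrite integral0.
  case: ifP => _; last by rewrite integral0.
  rewrite tailE mulrC -meanZ; last by integrability.
  rewrite EFin_mean; last by integrability.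
  by apply: eq_integral => y _; case: ifP => _; rewrite ?mulr1 ?mulr0.
transitivity (\int[F]_y \int[mu]_s (phi (s, y))%:E)%E.
  apply: (fubini_tonelli (EFin \o phi)); first exact/measurable_EFinP.
  by move=> p; rewrite lee_fin.
rewrite EFin_mean; last exact: integrable_overlap.
apply: eq_integral => y _; rewrite -integral_tail_itv; [|by piecewise..].
by apply: eq_integral => s _; congr EFin; rewrite /phi/=; piecewise.
Qed.

Lemma integral_tail : \int[mu]_(s in `[0, +oo[) Fb s = pos_mean F.
Proof.
have mM : measurable_fun [set: R] (fun y : R => Num.max y 0).
  by apply: measurable_maxr; integrability.
pose X : {RV F >-> R} := HB.pack (fun y : R => Num.max y 0)
  (isMeasurableFun.Build _ _ _ _ _ mM).
rewrite /pos_mean /mean /Rintegral; congr fine.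
have := @ge0_expectation_ccdf _ _ _ F X; rewrite expectation_def => ->; last first.
  by move=> y /=; piecewise.
apply: eq_integral => s /=; rewrite mem_setE in_itv/= andbT => s0.
rewrite /ccdf /distribution /pushforward/= /tail fineK ?fin_num_measure//.
congr (F _); apply/seteqP; split=> y /=; rewrite !in_itv/= !andbT;
  by piecewise.
Qed.

End tail_convolution.

(** * Consequences of membership in the class of strong subexponential laws *)

Section strong_subexponential.
Context {R : realType} (F : probability R R).
Implicit Types (x y z s t h e B X : R).

Notation Ex := (mean F).
Notation Fb := (tail F).
Notation a := (pos_mean F).

Lemma class_Sstar_overlap : class_Sstar F -> forall e, 0 < e ->
  exists2 X : R, 0 <= X & forall x, X <= x ->
    Ex (overlap F x) <= (2 * a + e) * Fb x.
Proof.
move=> [Fi Fpos]; rewrite integral_tail => /eqaddoP conv e e0.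
(* The error allowed by the equivalence is relative to [2 * a * tail F x]. *)
have a0 : 0 <= a by apply: mean_ge0 => y; piecewise.
have e'0 : 0 < e / (2 * a + 1) by rewrite divr_gt0//; lra.
have [X [_ XP]] := conv _ e'0.
exists (Num.max 0 (X + 1)); first by rewrite le_max lexx.
move=> x; rewrite ge_max => /andP[x0 Xx].
have /XP : X < x by lra.
rewrite /= !fctE /Rintegral (integral_tail_convolution Fi)//= => /ler_normlP[_].
rewrite [X in _ <= _ * X]ger0_norm; last by rewrite !mulr_ge0// tail_ge0.
move: (tail_ge0 F x) => p0 h; rewrite mulrDl -lerBlDl (le_trans h)//.
rewrite mulrAC ler_pdivrMr; last by lra.
by have := mulr_ge0 (ltW e0) p0; nra.
Qed.

Hypothesis Fi : integrableR F (fun y => y).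
Hypothesis Fpos : right_unbounded F.
Hypothesis Fconv : forall e, 0 < e -> exists2 X : R, 0 <= X &
  forall x, X <= x -> Ex (overlap F x) <= (2 * a + e) * Fb x.

Lemma overlap_ge0 x y : 0 <= x -> 0 <= overlap F x y.
Proof. by move=> x0; rewrite subr_ge0 itail_le//; piecewise. Qed.

Lemma overlap_above x y : 0 <= x -> x <= y -> overlap F x y = itail F x.
Proof.
move=> x0 xy; rewrite /overlap (_ : Num.max (x - _) 0 = 0) ?itail0 ?subr0//.
by piecewise.
Qed.

Lemma overlap_nonpos x y : 0 <= x -> y <= 0 -> overlap F x y = 0.
Proof.
move=> x0 y0; rewrite /overlap (_ : Num.max (x - _) 0 = x) ?subrr//.
by piecewise.
Qed.

Lemma overlap_mid x y : 0 <= y -> y <= x ->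
  overlap F x y = itail F x - itail F (x - y).
Proof.
move=> y0 yx; rewrite /overlap (_ : Num.max (x - _) 0 = x - y)//.
by piecewise.
Qed.

(** The jumps beyond [x], each with overlap [itail F x], already account for
    one half of the convolution; so only the other half is left to the jumps that
    stay below [x], whatever part of them is considered. *)
Lemma mean_overlap_below e : 0 < e -> exists2 X : R, 0 <= X &
  forall x z, X <= x -> z <= x ->
    Ex (fun y => if y <= z then overlap F x y else 0) <= (a + e) * Fb x.
Proof.
move=> e0.
have e20 : 0 < e / 2 by lra.
have [X1 X10 X1P] := Fconv e20.
have [X2 X20 X2P] := itail_near_pos_mean Fi e20.
exists (Num.max X1 X2); first by rewrite le_max X10.
move=> x z; rewrite ge_max => /andP[X1x X2x] zx.
have x0 : 0 <= x by lra.
have oi := integrable_overlap Fi x0.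
have : Ex (fun y => if y <= z then overlap F x y else 0) <=
       Ex (fun y => overlap F x y - itail F x * (if x < y then 1 else 0)).
  apply: le_mean; integrability => y.
  have := overlap_ge0 y x0.
  case: (ltP x y) => xy; last by case: ifP => _; lra.
  by rewrite overlap_above; [|lra|lra]; case: (leP y z); lra.
rewrite meanB; [|integrability|integrability].
rewrite meanZ -?tailE; last by integrability.
have := X1P _ X1x; have := ler_wpM2r (tail_ge0 F x) (X2P _ X2x).
by rewrite !mulrDl !mulNr; lra.
Qed.

(** The class is contained in that of long-tailed laws: if [F] lost a fixed
    proportion of its tail within distance [B], the convolution would exceed
    its two unavoidable contributions. *)
Lemma long_tailed B e : 0 <= B -> 0 < e -> exists2 X : R, 0 <= X &
  forall x, X <= x -> Fb x <= (1 + e) * Fb (x + B).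
Proof.
move=> B0 e0.
pose beta := a - itail F B.
have beta0 : 0 < beta.
  have := itail_le_pos_mean Fi (B + 1).
  have : (B + 1 - B) * Fb (B + 1) <= itail F (B + 1) - itail F B.
    by apply: (itail_diff_ge Fi); lra.
  by have := Fpos (B + 1); rewrite /beta; lra.
pose e' := Num.min (e * beta / 6) (beta / 2).
have e'0 : 0 < e' by have := mulr_gt0 e0 beta0; rewrite /e'; piecewise.
have [X1 X10 X1P] := Fconv e'0.
have [X2 X20 X2P] := itail_near_pos_mean Fi e'0.
have [X3 X30 X3P] := mean_above_small Fi e'0.
exists (Num.max X1 (Num.max X2 X3)); first by rewrite !le_max X10.
move=> x'; rewrite !ge_max => /and3P[X1x X2x X3x].
suff {x' X1x X2x X3x} main x : X1 <= x -> X2 <= x -> X3 <= x -> B <= x ->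
    Fb (x - B) <= (1 + e) * Fb x.
  by have := main (x' + B); rewrite addrK; apply; lra.
move=> X1x X2x X3x Bx.
have x0 : 0 <= x by lra.
have oi := integrable_overlap Fi x0.
pose up y := if y <= x then Num.max y 0 else 0.
pose over y := if y <= x then Num.max (y - B) 0 else 0.
have upi : integrableR F up by rewrite /up; integrability.
have overi : integrableR F over by rewrite /over; integrability.
have upE : a - e' <= Ex up.
  rewrite lerBlDl -lerBlDr (le_trans _ X3P)// -meanB; [|integrability..].
  apply: le_mean; integrability => y; have := ler_norm y; have := normr_ge0 y.
  by rewrite /up; clear -X3x; piecewise.
have overE : beta - e' <= Ex over.
  have -> : beta = Ex (fun y => Num.max (y - B) 0).
    rewrite /beta -meanB; [|integrability..].
    by apply: eq_mean => y; clear -B0; piecewise.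
  rewrite lerBlDl -lerBlDr (le_trans _ X3P)// -meanB; [|integrability..].
  apply: le_mean; integrability => y; have := ler_norm y; have := normr_ge0 y.
  by rewrite /over; clear -B0 X30 X3x; piecewise.
(* Jumps beyond [x] contribute [itail F x]; a jump [y <= x] contributes its
   first [B] units at the rate [Fb x] and the others at the rate [Fb (x - B)]. *)
have low : itail F x * Fb x + Fb x * (Ex up - Ex over) + Fb (x - B) * Ex over
    <= Ex (overlap F x).
  rewrite {1}tailE -!meanB -?meanZ -?meanD; [|integrability..].
  apply: le_mean; integrability => y.
  have := overlap_ge0 y x0.
  rewrite /up /over; clear -Fi x0 B0 Bx.
  case: (ltP x y) => xy; first by rewrite overlap_above; lra.
  case: (leP y 0) => y0.
    have -> : Num.max (y - B) 0 = 0 by piecewise.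
    by lra.
  rewrite overlap_mid//; last by lra.
  move=> _; case: (leP y B) => yB.
    have -> : Num.max (y - B) 0 = 0 by piecewise.
    by have : (x - (x - y)) * Fb x <= itail F x - itail F (x - y);
      [apply: (itail_diff_ge Fi); lra|lra].
  have -> : Num.max (y - B) 0 = y - B by piecewise.
  have : (x - (x - B)) * Fb x <= itail F x - itail F (x - B).
    by apply: (itail_diff_ge Fi); lra.
  have : (x - B - (x - y)) * Fb (x - B) <= itail F (x - B) - itail F (x - y).
    by apply: (itail_diff_ge Fi); lra.
  by lra.
have := X1P _ X1x; have := X2P _ X2x.
have e'1 : e' <= e * beta / 6 by rewrite /e'; piecewise.
have e'2 : e' <= beta / 2 by rewrite /e'; piecewise.
have := @tail_nonincreasing _ F (x - B) x; have := Fpos x.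
move: upE overE low.
set p := Fb x; set q := Fb (x - B); set i := itail F x; set A := Ex over.
set U := Ex up => UE AE low p0 qp iE XE.
have {}qp : p <= q by apply: qp; lra.
have : A * (q - p) <= 3 * e' * p by nra.
have : beta / 2 * (q - p) <= A * (q - p) by rewrite ler_wpM2r//; lra.
have : 3 * e' * p <= beta / 2 * (e * p) by nra.
move=> h1 h2 h3.
have : beta / 2 * (q - p) <= beta / 2 * (e * p) by lra.
by rewrite ler_pM2l; lra.
Qed.

End strong_subexponential.

(** * Markov chains driven by an independent sequence *)

Section markov.
Context d {T : measurableType d} {R : realType} (P : probability T R).
Variables (X : nat -> {RV P >-> R}) (f : R -> R -> R) (w0 : R).
Hypothesis mf : measurable_fun [set: R * R] (fun p : R * R => f p.1 p.2).

Fixpoint chain n (t : T) : R :=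
  if n is m.+1 then f (chain m t) (X m t) else w0.

Lemma measurable_chain n : measurable_fun [set: T] (chain n).
Proof.
elim: n => [|n ih]; first exact: measurable_cst.
have mp : measurable_fun [set: T] (fun t => (chain n t, X n t)).
  by apply: measurable_fun_pair.
exact: (measurableT_comp mf mp).
Qed.

HB.instance Definition _ n :=
  isMeasurableFun.Build _ _ _ _ (chain n) (measurable_chain n).

Let law n := distribution P (chain n).

Let pair n (t : T) := (chain n t, X n t).

Let mpair n : measurable_fun [set: T] (pair n).
Proof. by apply: measurable_fun_pair => //; exact: measurable_chain. Qed.

Hypothesis indepX : mutually_independent P X.

Definition cylinder (J : {fset nat}) (B : nat -> set R) : set T :=
  \bigcap_(i in [set` J]) (X i @^-1` B i).

Lemma measurable_cylinder J B : (forall i, i \in J -> measurable (B i)) ->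
  measurable (cylinder J B).
Proof.
move=> mB; apply: fin_bigcap_measurable; first exact: finite_fset.
by move=> i /mB mBi; rewrite -[X in measurable X]setTI; exact: measurable_funPT.
Qed.

(** The state at time [n] is independent of the inputs from time [n] on. Letting
    the whole future take part in the statement is what makes the induction close:
    the input used at the next step is then one more factor of the cylinder. *)
Let nonanticipating n := forall A J B, measurable A ->
  (forall i, i \in J -> (n <= i)%N) -> (forall i, i \in J -> measurable (B i)) ->
  P (chain n @^-1` A `&` cylinder J B) =
    (P (chain n @^-1` A) * P (cylinder J B))%E.

(** On rectangles this is [nonanticipating n]; rectangles determine a finite
    measure on the product. *)
Let pair_law n : nonanticipating n -> forall J B C,
  (forall i, i \in J -> (n < i)%N) -> (forall i, i \in J -> measurable (B i)) ->
  measurable C ->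
  P (pair n @^-1` C `&` cylinder J B) =
    (P (cylinder J B) * (law n \x distribution P (X n)) C)%E.
Proof.
move=> nonant J B C Jn mB mC.
have mE := measurable_cylinder mB.
pose r : {nonneg R} := NngNum (fine_ge0 (measure_ge0 P (cylinder J B))).
have rE : (r%:num%:E = P (cylinder J B))%E by rewrite fineK// fin_num_measure.
pose m1 := measure_function_pushforward__canonical__measure_function_Measure
  (measure_function_mrestr__canonical__measure_function_Measure P mE) (mpair n).
pose m2 := mscale r (law n \x distribution P (X n))%E.
rewrite -rE -[RHS]/(m2 C) -[LHS]/(m1 C).
pose G : set (set (R * R)) :=
  [set A `*` B | A in @measurable _ R & B in @measurable _ R].
apply: (measure_unique G (fun=> setT)) => //.
- by rewrite measurable_prod_measurableType.
- move=> _ _ [A1 mA1 [B1 mB1 <-]] [A2 mA2 [B2 mB2 <-]].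
  exists (A1 `&` A2); first exact: measurableI.
  by exists (B1 `&` B2); [exact: measurableI|rewrite setXI].
- by move=> _; exists setT => //; exists setT => //; rewrite setXTT.
- by rewrite bigcup_const.
- move=> _ [A mA [D mD <-]].
  have nJ : n \notin J by apply/negP => /Jn; rewrite ltnn.
  pose B' i := if i == n then D else B i.
  have mB' i : i \in (n |` J)%fset -> measurable (B' i).
    by rewrite in_fset1U /B'; case: eqP => //= _ /mB.
  have cylE : cylinder (n |` J)%fset B' = X n @^-1` D `&` cylinder J B.
    apply/seteqP; split=> t.
      move=> h; split; first by have := h n; rewrite /B' eqxx /= fset1U1; exact.
      move=> i /= iJ; have := h i; rewrite /B'; case: eqP => [iE|_].
        by rewrite iE in iJ; rewrite iJ in nJ.
      by apply; rewrite /= in_fset1U iJ orbT.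
    move=> [h1 h2] i /=; rewrite in_fset1U /B'; case: eqP => [-> //|_ /= iJ].
    exact: h2.
  transitivity (P (chain n @^-1` A `&` cylinder (n |` J)%fset B')).
    by rewrite cylE setIA.
  rewrite nonant//; last first.
    by move=> i; rewrite in_fset1U => /orP[/eqP -> //|/Jn /ltnW].
  rewrite /cylinder indepX// big_fsetU1//= {1}/B' eqxx.
  have -> : (\prod_(i <- J) P (X i @^-1` B' i) =
             \prod_(i <- J) P (X i @^-1` B i))%E.
    apply: eq_big_seq => i iJ; rewrite /B'; case: eqP => // iE.
    by rewrite iE in iJ; rewrite iJ in nJ.
  rewrite -indepX// -/(cylinder J B) -rE.
  by rewrite /m2 /mscale/= product_measure1E//= muleA [RHS]muleC.
- move=> _; rewrite /m1 /= /pushforward /mrestr/=.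
  by apply: le_lt_trans (ltry 1); apply: probability_le1; rewrite preimage_setT setTI.
Qed.

Let nonanticipating_chain n : nonanticipating n.
Proof.
elim: n => [|n ih] A J B mA Jn mB.
  rewrite /= /preimage/=; have [w0A|w0A] := pselect (A w0).
    rewrite (_ : [set _ | A w0] = setT); last by apply/seteqP; split.
    by rewrite setTI probability_setT mul1e.
  rewrite (_ : [set _ | A w0] = set0); last by apply/seteqP; split.
  by rewrite set0I measure0 mul0e.
pose C : set (R * R) := (fun p => f p.1 p.2) @^-1` A.
have mC : measurable C by rewrite -[X in measurable X]setTI; exact: mf.
have key := pair_law ih _ _ mC.
rewrite -[LHS]/(P (pair n @^-1` C `&` cylinder J B)) key//.
have := key fset0 (fun=> setT); rewrite /cylinder set_fset0 bigcap_set0 setIT.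
rewrite probability_setT mul1e => /(_ _ _)/= <-//.
by rewrite muleC.
Qed.

Variable F : probability R R.
Hypothesis lawX : forall n B, measurable B -> distribution P (X n) B = F B.

Definition transition (g : R -> R) w : R := mean F (fun y => g (f w y)).

Lemma measurable_transition (g : R -> R) : measurable_fun [set: R] g ->
  (forall y, 0 <= g y) -> measurable_fun [set: R] (transition g).
Proof.
move=> mg g0.
have mgf := measurableT_comp mg mf.
apply: (measurableT_comp (fine_measurable measurableT)).
apply: (measurable_fun_fubini_tonelli_F (fun p => (g (f p.1 p.2))%:E)) => [|p].
  exact/measurable_EFinP.
by rewrite lee_fin.
Qed.

Lemma transition_itv (g : R -> R) : measurable_fun [set: R] g ->
  (forall y, 0 <= g y <= 1) -> forall w, 0 <= transition g w <= 1.
Proof.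
move=> mg g01 w; apply/andP; split.
  by apply: mean_ge0 => y; have /andP[] := g01 (f w y).
rewrite -[leRHS](mean_cst F); apply: le_mean; [|exact: integrableR_cst|].
  apply: (@integrableR_bounded _ _ _ _ _ 1).
    apply: (measurableT_comp mg); exact: (measurableT_comp mf (measurable_pair1 w)).
  by move=> y; have /andP[] := g01 (f w y); rewrite ler_norml; lra.
by move=> y; have /andP[] := g01 (f w y).
Qed.

(** The last input is integrated out first, hence the iteration of the
    one-step operator. *)
Lemma mean_chain n (g : R -> R) : measurable_fun [set: R] g ->
  (forall y, 0 <= g y <= 1) ->
  mean P (fun t => g (chain n t)) = iter n transition g w0.
Proof.
elim: n g => [|n ih] g mg g01; first by rewrite /= mean_cst.
rewrite iterSr -ih; last 2 first.
- by apply: measurable_transition => // y; have /andP[] := g01 y.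
- exact: transition_itv.
rewrite /mean /Rintegral; congr fine.
have mgf := measurableT_comp mg mf.
have g0 y : (0 <= (g y)%:E)%E by rewrite lee_fin; have /andP[] := g01 y.
transitivity (\int[law n \x distribution P (X n)]_p (g (f p.1 p.2))%:E)%E.
  pose pairRV : {RV P >-> (R * R)%type} := HB.pack (pair n)
    (isMeasurableFun.Build _ _ _ _ _ (mpair n)).
  rewrite (@eq_measure_integral _ _ _ _ (distribution P pairRV)); last first.
    move=> C mC _; have := pair_law (@nonanticipating_chain n).
    move=> /(_ fset0 (fun=> setT) C); rewrite /cylinder set_fset0 bigcap_set0 setIT.
    by rewrite probability_setT mul1e => key; apply/esym/key.
  rewrite ge0_integral_distribution//.
  exact/measurable_EFinP.
rewrite (fubini_tonelli1 (fun p => (g (f p.1 p.2))%:E))//; last first.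
  exact/measurable_EFinP.
rewrite ge0_integral_distribution//; last 2 first.
- apply: (measurable_fun_fubini_tonelli_F (fun p => (g (f p.1 p.2))%:E)) => //.
  exact/measurable_EFinP.
- by move=> w; exact: integral_ge0.
apply: eq_integral => t _; rewrite /fubini_F/=.
rewrite (@eq_measure_integral _ _ _ _ F); last by move=> C mC _; exact: lawX.
rewrite /transition EFin_mean//.
apply: (@integrableR_bounded _ _ _ _ _ 1).
  apply: (measurableT_comp mg).
  exact: (measurableT_comp mf (measurable_pair1 _)).
by move=> y; have /andP[] := g01 (f (chain n t) y); rewrite ler_norml; lra.
Qed.

End markov.

(** * Tails of sums and of maxima by recursion *)

Section walk_tails.
Context {R : realType} (F : probability R R).
Implicit Types (x y w c : R) (n : nat).

Notation Ex := (mean F).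

Definition positive_indicator w : R := if 0 < w then 1 else 0.

Definition walk_step w y : R := w + y.

(** The walk is frozen once it is positive, so that being positive at time [n]
    means having been positive at some time up to [n]. *)
Definition stopped_step c w y : R := if 0 < w then w else w + y - c.

(** The probability that a sum of [n] independent terms with law [F]
    exceeds [x]. *)
Definition sum_tail n x : R :=
  iter n (transition walk_step F) positive_indicator (- x).

(** The probability that a walk with increments [y - c], [y] of law [F],
    exceeds [x] within [n] steps. *)
Definition max_tail c n x : R :=
  iter n (transition (stopped_step c) F) positive_indicator (- x).

Lemma measurable_positive_indicator :
  measurable_fun [set: R] positive_indicator.
Proof. by apply: measurable_fun_ifT; integrability. Qed.

Lemma positive_indicator_itv w : 0 <= positive_indicator w <= 1.
Proof. by rewrite /positive_indicator; case: ifP => _; rewrite ?lexx ler01. Qed.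

Lemma measurable_walk_step :
  measurable_fun [set: R * R] (fun p : R * R => walk_step p.1 p.2).
Proof.
by apply: measurable_funD; [exact: measurable_fst|exact: measurable_snd].
Qed.

Lemma measurable_stopped_step c :
  measurable_fun [set: R * R] (fun p : R * R => stopped_step c p.1 p.2).
Proof.
have m1 : measurable_fun [set: R * R] (fun p : R * R => p.1).
  exact: measurable_fst.
have m2 : measurable_fun [set: R * R] (fun p : R * R => p.2).
  exact: measurable_snd.
by apply: measurable_fun_ifT; integrability.
Qed.

Lemma iter_transition_regular (f : R -> R -> R) n (g : R -> R) :
  measurable_fun [set: R * R] (fun p : R * R => f p.1 p.2) ->
  measurable_fun [set: R] g -> (forall w, 0 <= g w <= 1) ->
  measurable_fun [set: R] (iter n (transition f F) g) /\
  forall w, 0 <= iter n (transition f F) g w <= 1.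
Proof.
move=> mf mg g01; elim: n => [//|n [ihm ih01]] /=; split.
  by apply: measurable_transition => // y; have /andP[] := ih01 y.
exact: transition_itv.
Qed.

Lemma sum_tail_itv n x : 0 <= sum_tail n x <= 1.
Proof.
have [_] := iter_transition_regular n measurable_walk_step
  measurable_positive_indicator positive_indicator_itv.
exact.
Qed.

Lemma measurable_sum_tail n : measurable_fun [set: R] (sum_tail n).
Proof.
have [m _] := iter_transition_regular n measurable_walk_step
  measurable_positive_indicator positive_indicator_itv.
by apply: (measurableT_comp m); integrability.
Qed.

Lemma max_tail_itv c n x : 0 <= max_tail c n x <= 1.
Proof.
have [_] := iter_transition_regular n (measurable_stopped_step c)
  measurable_positive_indicator positive_indicator_itv.
exact.
Qed.

Lemma measurable_max_tail c n : measurable_fun [set: R] (max_tail c n).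
Proof.
have [m _] := iter_transition_regular n (measurable_stopped_step c)
  measurable_positive_indicator positive_indicator_itv.
by apply: (measurableT_comp m); integrability.
Qed.

Lemma sum_tail0 x : sum_tail 0 x = if x < 0 then 1 else 0.
Proof. by rewrite /sum_tail/= /positive_indicator oppr_gt0. Qed.

Lemma sum_tailS n x : sum_tail n.+1 x = Ex (fun y => sum_tail n (x - y)).
Proof.
rewrite /sum_tail iterS {1}/transition; apply: eq_mean => y.
by rewrite /walk_step opprB addrC.
Qed.

Lemma max_tail0 c x : 0 <= x -> max_tail c 0 x = 0.
Proof.
by move=> x0; rewrite /max_tail/= /positive_indicator oppr_gt0 ltNge x0.
Qed.

Lemma max_tailS c n x : 0 <= x ->
  max_tail c n.+1 x = Ex (fun y => max_tail c n (x + c - y)).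
Proof.
move=> x0; rewrite /max_tail iterS {1}/transition; apply: eq_mean => y.
rewrite /stopped_step oppr_gt0 ltNge x0/=; congr (iter _ _ _ _); lra.
Qed.

End walk_tails.

Section partial_sums.
Context {T : Type} {R : realType} (xi : nat -> T -> R).
Implicit Types (x c : R) (n : nat) (t : T).

Lemma lt_partial_max n x t :
  (x < partial_max xi n t) = [exists i : 'I_n.+1, x < partial_sum xi i t].
Proof.
apply/idP/existsP => [|[i xi_]].
  rewrite /partial_max; elim/big_ind: _ => [x0|u v uE vE|i _ xi_].
  - by exists ord0.
  - by rewrite lt_max => /orP[/uE|/vE].
  - by exists i.
by apply: (lt_le_trans xi_); rewrite /partial_max; apply: le_bigmax_cond.
Qed.

Lemma partial_max_le_drift c n t : 0 <= c ->
  partial_max xi n t <= partial_max (fun i t => xi i t - c) n t + c * n%:R.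
Proof.
move=> c0; rewrite leNgt lt_partial_max; apply/existsP => -[i].
apply/negP; rewrite -leNgt.
have : partial_sum (fun i t => xi i t - c) i t <=
       partial_max (fun i t => xi i t - c) n t.
  by rewrite /partial_max; apply: le_bigmax_cond.
have -> : partial_sum (fun i t => xi i t - c) i t =
    partial_sum xi i t - c * i%:R.
  by rewrite /partial_sum sumrB sumr_const card_ord mulr_natr.
have : c * i%:R <= c * n%:R by rewrite ler_wpM2l// ler_nat -ltnS.
lra.
Qed.

End partial_sums.

Lemma measurable_partial_sum d (T : measurableType d) (R : realType)
    (xi : nat -> T -> R) n : (forall i, measurable_fun [set: T] (xi i)) ->
  measurable_fun [set: T] (partial_sum xi n).
Proof. by move=> mxi; apply: measurable_sum. Qed.

Lemma measurable_partial_max_event d (T : measurableType d) (R : realType)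
    (xi : nat -> T -> R) n x : (forall i, measurable_fun [set: T] (xi i)) ->
  measurable [set t | x < partial_max xi n t].
Proof.
move=> mxi.
rewrite (_ : [set t | _] =
    \bigcup_(i in [set: 'I_n.+1]) [set t | x < partial_sum xi i t]).
  apply: fin_bigcup_measurable => // i _.
  exact/measurable_lt_event/measurable_partial_sum.
apply/seteqP; split=> t /=; rewrite lt_partial_max.
  by move=> /existsP[i xi_]; exists i.
by move=> [i _ xi_]; apply/existsP; exists i.
Qed.

Section walk_probabilities.
Context d {T : measurableType d} {R : realType} (P : probability T R).
Variables (X : nat -> {RV P >-> R}) (F : probability R R).
Hypothesis indepX : mutually_independent P X.
Hypothesis lawX : forall n B, measurable B -> distribution P (X n) B = F B.
Implicit Types (x c : R) (n : nat) (t : T).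

Let measurable_chain_pos f w0 n :
  measurable_fun [set: R * R] (fun p : R * R => f p.1 p.2) ->
  measurable_fun [set: T] (fun t => (0 : R) < chain X f w0 n t).
Proof.
move=> mf; have mc := measurable_chain X w0 mf n.
by integrability.
Qed.

Lemma probability_sum n x :
  fine (P [set t | x < partial_sum X n t]) = sum_tail F n x.
Proof.
have mf := @measurable_walk_step R.
rewrite /sum_tail -(mean_chain (- x) mf indepX lawX n (@measurable_positive_indicator R)
  (@positive_indicator_itv R)).
rewrite mean_if; last exact: measurable_chain_pos.
congr (fine (P _)); apply/funext => t /=.
suff -> : chain X (@walk_step R) (- x) n t = partial_sum X n t - x.
  by rewrite subr_gt0.
elim: n => [|n ih] /=; first by rewrite /partial_sum big_ord0 sub0r.
by rewrite /walk_step ih /partial_sum big_ord_recr/=; lra.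
Qed.

Lemma probability_max c n x :
  fine (P [set t | x < partial_max (fun i t => X i t - c) n t])
  = max_tail F c n x.
Proof.
have mf := @measurable_stopped_step R c.
rewrite /max_tail -(mean_chain (- x) mf indepX lawX n (@measurable_positive_indicator R)
  (@positive_indicator_itv R)).
rewrite mean_if; last exact: measurable_chain_pos.
congr (fine (P _)); apply/funext => t /=.
rewrite lt_partial_max; set xi := fun i t => X i t - c.
set W := chain X (stopped_step c) (- x).
suff [Wgt Wle] : (0 < W n t = [exists i : 'I_n.+1, x < partial_sum xi i t])
    /\ (W n t <= 0 -> W n t = partial_sum xi n t - x).
  by rewrite Wgt.
elim: n => [|n [ih1 ih2]].
  have W0 : W 0 t = - x by [].
  split; last by rewrite W0 /partial_sum big_ord0 sub0r.
  rewrite W0 oppr_gt0; apply/idP/existsP => [x0|[i]].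
    by exists ord0; rewrite /partial_sum big_ord0.
  by rewrite (ord1 i) /partial_sum big_ord0.
have WS : W n.+1 t = stopped_step c (W n t) (X n t) by [].
have exS : [exists i : 'I_n.+2, x < partial_sum xi i t] =
   (0 < W n t) || (x < partial_sum xi n.+1 t).
  rewrite ih1; apply/existsP/orP => [[i]|[/existsP[i hi]|hn]].
  - have [iE|ni] := eqVneq (i : nat) n.+1; first by rewrite iE; right.
    have ilt : (i < n.+1)%N by rewrite ltn_neqAle ni -ltnS ltn_ord.
    by move=> hi; left; apply/existsP; exists (Ordinal ilt).
  - by exists (widen_ord (leqnSn _) i).
  - by exists ord_max.
have sumS : partial_sum xi n.+1 t = partial_sum xi n t + (X n t - c).
  by rewrite /partial_sum big_ord_recr.
rewrite exS WS /stopped_step; case: (ltP 0 (W n t)) => W0 /=.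
  by split; [exact/idP|lra].
rewrite (ih2 W0) sumS; split; last by lra.
by apply/idP/idP; lra.
Qed.

Lemma probability_partial_max n x :
  fine (P [set t | x < partial_max X n t]) = max_tail F 0 n x.
Proof.
rewrite -probability_max; congr (fine (P _)); apply/funext => t /=.
by congr (is_true (_ < partial_max _ _ _)); apply/funext => i; apply/funext => u;
  rewrite subr0.
Qed.

(** Subtracting [c] from every increment lowers the maximum by at most [c * n];
    this trades a nonnegative drift for a lower level. *)
Lemma probability_le_max_tail c n x : 0 <= c ->
  fine (P [set t | x < partial_max X n t]) <= max_tail F c n (x - c * n%:R).
Proof.
move=> c0; rewrite -probability_max; apply: le_probability.
- exact: measurable_partial_max_event.
- apply: measurable_partial_max_event => i.
  by apply: measurable_funB => //; exact: measurable_cst.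
- by move=> t /=; have := partial_max_le_drift X n t c0; lra.
Qed.

End walk_probabilities.

(** * Fixed number of summands *)

Section fixed_number.
Context {R : realType} (F : probability R R).
Implicit Types (x y z e B X : R) (n : nat).

Notation Ex := (mean F).
Notation Fb := (tail F).
Notation a := (pos_mean F).

Hypothesis Fi : integrableR F (fun y => y).
Hypothesis Fpos : right_unbounded F.
Hypothesis Fconv : forall e, 0 < e -> exists2 X : R, 0 <= X &
  forall x, X <= x -> Ex (overlap F x) <= (2 * a + e) * Fb x.

Lemma integrable_sum_tail n x : integrableR F (fun y => sum_tail F n (x - y)).
Proof.
apply: (@integrableR_bounded _ _ _ _ _ 1).
  apply: measurableT_comp; first exact: measurable_sum_tail.
  by integrability.
by move=> y; have /andP[] := sum_tail_itv F n (x - y); rewrite ler_norml; lra.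
Qed.

Lemma integrable_max_tail c n x :
  integrableR F (fun y => max_tail F c n (x - y)).
Proof.
apply: (@integrableR_bounded _ _ _ _ _ 1).
  apply: measurableT_comp; first exact: measurable_max_tail.
  by integrability.
by move=> y; have /andP[] := max_tail_itv F c n (x - y); rewrite ler_norml; lra.
Qed.

Lemma sum_tail_nonincreasing n x y : x <= y -> sum_tail F n y <= sum_tail F n x.
Proof.
elim: n x y => [|n ih] x y xy; first by rewrite !sum_tail0; piecewise.
rewrite !sum_tailS; apply: le_mean; [exact: integrable_sum_tail..|move=> t].
by apply: ih; rewrite lerD2r.
Qed.

Lemma mass_inside_large e : 0 < e -> exists2 B : R, 0 <= B &
  forall B', B <= B' -> 1 - e <= Ex (fun y => if `|y| <= B' then 1 else 0).
Proof.
move=> e0; have [B B0 Be] := mean_above_small Fi e0.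
exists (Num.max B 1); first by rewrite le_max B0.
move=> B'; rewrite ge_max => /andP[BB' B'1].
rewrite lerBlDl -lerBlDr -[X in X - _](mean_cst F) (le_trans _ Be)// -meanB;
  [|integrability..].
apply: le_mean; [integrability..|] => y; have := normr_ge0 y; clear -BB' B'1.
by piecewise.
Qed.

Lemma sum_tail_left n e : 0 < e -> exists2 B : R, 0 <= B & 1 - e <= sum_tail F n (- B).
Proof.
elim: n e => [|n ih] e e0.
  by exists 1 => //; rewrite sum_tail0; piecewise.
have e20 : 0 < e / 2 by lra.
have [B1 B10 B1P] := ih _ e20.
have [B2 B20 B2P] := mass_inside_large e20.
exists (B1 + B2); first exact: addr_ge0.
have low : (1 - e / 2) * Ex (fun y => if `|y| <= B2 then 1 else 0) <=
    sum_tail F n.+1 (- (B1 + B2)).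
  rewrite sum_tailS -meanZ; [|integrability].
  apply: le_mean; [integrability|exact: integrable_sum_tail|move=> y].
  case: ifP => yB; last by rewrite mulr0; case/andP: (sum_tail_itv F n (- (B1 + B2) - y)).
  rewrite mulr1 (le_trans B1P)// sum_tail_nonincreasing//.
  by move/ler_normlP: yB => [h1 h2]; lra.
have qe := B2P _ (lexx _); have /andP[s0 _] := sum_tail_itv F n.+1 (- (B1 + B2)).
have [e1|e1] := leP (e / 2) 1; last by apply: le_trans s0; lra.
apply: le_trans low; have : 0 <= 1 - e / 2 by lra.
move=> /(ler_wpM2l) /(_ _ _ qe); apply: le_trans.
by have := sqr_ge0 (e / 2); lra.
Qed.

(** One summand jumps over the level and the others stay bounded. *)
Lemma sum_tail_lower n e : 0 < e -> exists2 X : R, 0 <= X &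
  forall x, X <= x -> (n%:R - e) * Fb x <= sum_tail F n x.
Proof.
elim: n e => [|n ih] e e0.
  exists 0 => // x _; have := tail_ge0 F x; have /andP[+ _] := sum_tail_itv F 0 x.
  by rewrite sub0r mulNr => h1 h2; have := mulr_ge0 (ltW e0) h2; lra.
pose N : R := n.+1%:R.
have NE : N = n%:R + 1 by rewrite /N -natr1.
have N1 : 0 <= n%:R :> R by [].
pose e' := Num.min 1 (e / (2 * N + 1)).
have e'0 : 0 < e'.
  by rewrite lt_min ltr01/= divr_gt0//; lra.
have e'1 : e' <= 1 by rewrite ge_min lexx.
have e'e : e' * (2 * N + 1) <= e.
  by rewrite -ler_pdivlMr; [rewrite ge_min lexx orbT|lra].
have [X1 X10 X1P] := ih _ e'0.
have [B1 B10 B1P] := mass_inside_large e'0.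
have [B2 B20 B2P] := sum_tail_left n e'0.
pose B := B1 + B2.
have [X3 X30 X3P] := long_tailed Fi Fpos Fconv (addr_ge0 B10 B20) e'0.
exists (X1 + X3); first exact: addr_ge0.
move=> x Xx; have x0 : 0 <= x by lra.
have low : sum_tail F n (x + B) * Ex (fun y => if `|y| <= B then 1 else 0)
    + (1 - e') * Fb (x + B) <= sum_tail F n.+1 x.
  rewrite tailE sum_tailS -!meanZ; [|integrability..].
  rewrite -meanD; [|integrability..].
  apply: le_mean; [integrability|exact: integrable_sum_tail|move=> y].
  case: (leP `|y| B) => yB.
    move/ler_normlP: yB => [yB1 yB2].
    rewrite ifF; last by apply/negbTE; rewrite -leNgt; lra.
    by rewrite mulr0 mulr1 addr0 sum_tail_nonincreasing//; lra.
  rewrite mulr0 add0r; case: ifP => yx; last first.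
    by rewrite mulr0; case/andP: (sum_tail_itv F n (x - y)).
  rewrite mulr1 (le_trans B2P)// sum_tail_nonincreasing//.
  by move: yx; rewrite /B; lra.
have h1 := B1P B ltac:(by rewrite /B; lra).
have h2 := X1P (x + B) ltac:(by rewrite /B; lra).
have h3 := X3P x ltac:(lra).
have h4 := @tail_nonincreasing _ F x (x + B) ltac:(by rewrite /B; lra).
have h5 := tail_ge0 F (x + B).
have /andP[h6 _] := sum_tail_itv F n (x + B).
apply: le_trans low; move: h1 h2 h3 h4 h5 h6; rewrite -/B -/N.
set q := Ex _; set s := sum_tail _ _ _; set r := Fb (x + B); set p := Fb x.
clear -e'0 e'1 e'e NE N1 e0 => h1 h2 h3 h4 h5 h6.
have s1 : (1 - e') * s <= s * q by rewrite mulrC ler_wpM2l.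
have s2 : (1 - e') * ((n%:R - e') * r) <= (1 - e') * s.
  by rewrite ler_wpM2l// subr_ge0.
have main : (N - e) * p <= (1 - e') * (N - e') * r.
  have [eN|Ne] := leP e N; last first.
    have : 0 <= (1 - e') * (N - e') * r.
      by rewrite !mulr_ge0//; nra.
    by have : (N - e) * p <= 0; [nra|lra].
  have : (N - e) * p <= (N - e) * ((1 + e') * r) by rewrite ler_wpM2l// subr_ge0.
  move/le_trans; apply; rewrite mulrA ler_wpM2r//; nra.
apply: (le_trans main); rewrite NE in main *; nra.
Qed.

Lemma pos_mean_ge0 : 0 <= a.
Proof. by apply: mean_ge0 => y; piecewise. Qed.

Lemma measurable_tail_sub x : measurable_fun [set: R] (fun y => Fb (x - y)).
Proof.
by apply: measurableT_comp; [exact: measurable_tail|integrability].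
Qed.

Lemma integrable_tail_below x z :
  integrableR F (fun y => if y <= z then Fb (x - y) else 0).
Proof.
have mt := measurable_tail_sub x.
apply: (@integrableR_bounded _ _ _ _ _ 1).
  by apply: measurable_fun_ifT; integrability.
move=> y; have := tail_ge0 F (x - y); have := tail_le1 F (x - y).
by case: ifP => _; rewrite ler_norml; lra.
Qed.

(** The unit increments of the integrated tail stand in for the tail itself:
    for them a jump [y] costs the overlap and gains [y * tail F (x + 1)], and
    these two almost balance in the mean. *)
Lemma mean_tail_below e : 0 < e -> exists2 B : R, 0 <= B &
  forall B', B <= B' -> exists2 X : R, 0 <= X & forall x, X <= x ->
    Ex (fun y => if y <= x - B' then Fb (x - y) else 0) <= (1 + e) * Fb x.
Proof.
move=> e0; have a0 := pos_mean_ge0.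
pose e1 := Num.min 1 (e / (4 + a)).
have e10 : 0 < e1 by rewrite lt_min ltr01/= divr_gt0//; lra.
have e11 : e1 <= 1 by rewrite ge_min lexx.
have e1e : e1 * (4 + a) <= e.
  by rewrite -ler_pdivlMr; [rewrite ge_min lexx orbT|lra].
have [X1 X10 X1P] := long_tailed Fi Fpos Fconv ler01 e10.
exists X1 => // B BX1.
have [X2 X20 X2P] := mean_overlap_below Fi Fconv e10.
have [X3 X30 X3P] := mean_above_small Fi e10.
exists (X1 + X2 + X3 + B); first by rewrite !addr_ge0//; lra.
move=> x Xx; have x0 : 0 <= x by lra.
pose G z := itail F (z + 1) - itail F z.
pose up y := if y <= x - B then Num.max y 0 else 0.
have upi : integrableR F up by rewrite /up; integrability.
have upE : a - e1 <= Ex up.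
  rewrite lerBlDl -lerBlDr (le_trans _ X3P)// -meanB; [|integrability..].
  apply: le_mean; [integrability..|] => y.
  have := ler_norm y; have := normr_ge0 y.
  rewrite /up; have : X3 <= x - B by lra.
  by set z := x - B; clear -X30; piecewise.
pose ov y := if y <= x - B then overlap F x y else 0.
have ovi : integrableR F ov.
  have := integrable_overlap Fi x0; rewrite /ov => oi; integrability.
have bound : Ex (fun y => if y <= x - B then Fb (x - y) else 0) <=
    (1 + e1) * (G x + Ex ov - Fb (x + 1) * Ex up).
  rewrite -(meanZ (Fb (x + 1)) upi) -[G x](mean_cst F) -meanD; [|integrability..].
  rewrite -meanB; [|integrability..].
  rewrite -meanZ; [|integrability].
  apply: le_mean; [exact: integrable_tail_below|integrability|move=> y].
  rewrite /ov /up; case: ifP => yx; last first.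
    rewrite mulr0 addr0 subr0 mulr_ge0//; first by lra.
    by rewrite subr_ge0 itail_le//; lra.
  apply: (le_trans (X1P (x - y) _)); first by lra.
  rewrite ler_wpM2l//; first by lra.
  have : (x - y + 1 - (x - y)) * Fb (x - y + 1) <=
         itail F (x - y + 1) - itail F (x - y).
    by apply: (itail_diff_ge Fi); lra.
  have -> : x - y + 1 - (x - y) = 1 by lra.
  rewrite mul1r => /le_trans; apply.
  case: (leP y 0) => y0.
    rewrite overlap_nonpos//.
    have := @itail_concave _ F Fi x (x - y) 1 ltac:(lra) ltac:(lra).
    by rewrite /G mulr0; lra.
  rewrite overlap_mid//; [|lra|lra].
  have : (x + 1 - (x - y + 1)) * Fb (x + 1) <=
         itail F (x + 1) - itail F (x - y + 1).
    by apply: (itail_diff_ge Fi); lra.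
  by rewrite /G; lra.
have h1 : Ex ov <= (a + e1) * Fb x by apply: X2P; lra.
have h2 : Fb x <= (1 + e1) * Fb (x + 1) by apply: X1P; lra.
have h3 : G x <= Fb x.
  have := @itail_diff_le _ F Fi x (x + 1) x0 ltac:(lra).
  by rewrite /G; lra.
have U0 : 0 <= Ex up by apply: mean_ge0 => y; rewrite /up; piecewise.
have p0 := tail_ge0 F x.
apply: (le_trans bound); move: upE h1 h2 h3 U0 p0.
set U := Ex up; set V := Ex ov; set g := G x; set p := Fb x; set r := Fb (x + 1).
clear -e10 e11 e1e a0 => upE h1 h2 h3 U0 p0.
have k1 : p * U <= (1 + e1) * r * U by rewrite ler_wpM2r.
have k2 : p * (a - e1) <= p * U by rewrite ler_wpM2l.
have k3 : (1 + e1) * (g + V) <= (1 + e1) * (p + (a + e1) * p).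
  by rewrite ler_wpM2l//; lra.
have k4 : e1 * (4 + a) * p <= e * p by rewrite ler_wpM2r.
have k5 : e1 * e1 * p <= e1 * 1 * p by rewrite ler_wpM2r// ler_wpM2l//; lra.
by lra.
Qed.

(** Either the first jump already comes within [B] of [x], or the remaining
    distance is at least [B] and the bound for the other [n] steps applies. *)
Lemma max_tail_upper n e : 0 < e -> exists2 X : R, 0 <= X &
  forall x, X <= x -> max_tail F 0 n x <= (n%:R + e) * Fb x.
Proof.
elim: n e => [|n ih] e e0.
  by exists 0 => // x x0; rewrite max_tail0// mulr_ge0 ?tail_ge0//; lra.
pose N : R := n.+1%:R.
have NE : N = n%:R + 1 by rewrite /N -natr1.
have N1 : 0 <= n%:R :> R by [].
pose e' := Num.min 1 (e / (N + 2)).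
have e'0 : 0 < e' by rewrite lt_min ltr01/= divr_gt0//; lra.
have e'1 : e' <= 1 by rewrite ge_min lexx.
have e'e : e' * (N + 2) <= e.
  by rewrite -ler_pdivlMr; [rewrite ge_min lexx orbT|lra].
have [X1 X10 X1P] := ih _ e'0.
have [B0 B00 B0P] := mean_tail_below e'0.
pose B := B0 + X1.
have B_ge0 : 0 <= B by apply: addr_ge0.
have [X2 X20 X2P] := B0P B ltac:(by rewrite /B; lra).
have [X3 X30 X3P] := long_tailed Fi Fpos Fconv B_ge0 e'0.
exists (X2 + X3 + B); first by rewrite !addr_ge0.
move=> x Xx; have x0 : 0 <= x by lra.
have bound : max_tail F 0 n.+1 x <= Fb (x - B) +
    (n%:R + e') * Ex (fun y => if y <= x - B then Fb (x - y) else 0).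
  have ti := integrable_tail_below x (x - B).
  rewrite max_tailS// addr0 tailE -meanZ// -meanD; [|integrability..].
  apply: le_mean; [exact: integrable_max_tail|integrability|move=> y].
  case: (leP y (x - B)) => yx.
    by rewrite add0r X1P//; move: yx; rewrite /B; lra.
  by rewrite mulr0 addr0; case/andP: (max_tail_itv F 0 n (x - y)).
have h1 := X2P x ltac:(lra).
have h2 := X3P (x - B) ltac:(lra).
rewrite subrK in h2.
have p0 := tail_ge0 F x.
apply: (le_trans bound); rewrite -/N.
move: h1 h2 p0; set q := Ex _; set p := Fb x; set r := Fb (x - B).
clear -e'0 e'1 e'e NE N1 => h1 h2 p0.
have k1 : (n%:R + e') * q <= (n%:R + e') * ((1 + e') * p).
  by rewrite ler_wpM2l//; lra.
have k4 : e' * (N + 2) * p <= e * p by rewrite ler_wpM2r.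
have k5 : e' * e' * p <= e' * 1 * p by rewrite ler_wpM2r// ler_wpM2l//; lra.
by rewrite NE in k4 *; lra.
Qed.

End fixed_number.

(** * A bound uniform in the number of summands *)

Section uniform_bound.
Context {R : realType} (F : probability R R).
Implicit Types (x y z e h c B X K L : R) (n : nat).

Notation Ex := (mean F).
Notation Fb := (tail F).
Notation a := (pos_mean F).

Hypothesis Fi : integrableR F (fun y => y).
Hypothesis Fpos : right_unbounded F.
Hypothesis Fconv : forall e, 0 < e -> exists2 X : R, 0 <= X &
  forall x, X <= x -> Ex (overlap F x) <= (2 * a + e) * Fb x.

Definition truncated_neg_mean B := Ex (fun y => Num.min (Num.max (- y) 0) B).

Lemma truncated_neg_mean_near e : 0 < e -> exists2 B : R, 0 <= B &
  a - Ex (fun y => y) - e <= truncated_neg_mean B.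
Proof.
move=> e0; have [B B0 Be] := mean_above_small Fi e0; exists B => //.
rewrite lerBlDl -lerBlDr (le_trans _ Be)// -!meanB; [|integrability..].
apply: le_mean; [integrability..|] => y.
by have := ler_norm (- y); have := normr_ge0 y; rewrite normrN; clear -B0; piecewise.
Qed.

Lemma truncated_neg_mean_ge0 B : 0 <= B -> 0 <= truncated_neg_mean B.
Proof. by move=> B0; apply: mean_ge0 => y; piecewise. Qed.

Lemma integrable_window h x z : 0 <= h -> z <= x ->
  integrableR F
    (fun y => if y <= z then itail F (x - y + h) - itail F (x - y) else 0).
Proof.
move=> h0 zx; have mI : measurable_fun [set: R] (itail F).
  exact: measurable_itail.
have m1 : measurable_fun [set: R] (fun y => itail F (x - y + h)).
  by apply: (measurableT_comp mI); integrability.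
have m2 : measurable_fun [set: R] (fun y => itail F (x - y)).
  by apply: (measurableT_comp mI); integrability.
apply: (@integrableR_bounded _ _ _ _ _ (h * Fb 0)).
  by apply: measurable_fun_ifT; integrability.
move=> y; case: ifP => yz; last by rewrite normr0 mulr_ge0// tail_ge0.
rewrite ger0_norm; last by rewrite subr_ge0 itail_le//; lra.
have := @itail_concave _ F Fi 0 (x - y) h ltac:(lra) h0.
by have := @itail_diff_le _ F Fi 0 (0 + h) (lexx _) ltac:(lra); lra.
Qed.

(** Moving the window of length [h] at [x] by a jump: an upward jump adds at most
    its overlap at the left end; a downward jump, cut off at [B], removes tail at
    the rate [Fb (x + B)] or more at the left end and adds it at the rate
    [Fb (x + h)] or less at the right end. *)
Lemma mean_window_below B h x z : 0 <= B -> 0 <= h -> 0 <= z -> z <= x ->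
  Ex (fun y => if y <= z then itail F (x - y + h) - itail F (x - y) else 0) <=
  itail F (x + h) - itail F x +
    (Fb (x + h) - Fb (x + B)) * truncated_neg_mean B +
    Ex (fun y => if y <= z then overlap F x y else 0).
Proof.
move=> B0 h0 z0 zx; have x0 : 0 <= x by lra.
have oi : integrableR F (fun y => if y <= z then overlap F x y else 0).
  by have := integrable_overlap Fi x0 => oi; integrability.
have ni : integrableR F (fun y => Num.min (Num.max (- y) 0) B) by integrability.
have G0 t : 0 <= itail F (t + h) - itail F t by rewrite subr_ge0 itail_le//; lra.
have Gi := integrable_window h0 zx.
rewrite -[X in X + _ * _](mean_cst F) -meanZ// -meanD; [|integrability..].
rewrite -meanD; [|integrability..].
apply: le_mean; [exact: Gi|integrability|move=> y].
case: (leP y z) => yz; last first.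
  have -> : Num.max (- y) 0 = 0 by clear -yz z0; piecewise.
  have -> : Num.min 0 B = 0 by clear -B0; piecewise.
  by rewrite mulr0 !addr0.
case: (leP y 0) => y0; last first.
  have -> : Num.max (- y) 0 = 0 by clear -y0; piecewise.
  have -> : Num.min 0 B = 0 by clear -B0; piecewise.
  rewrite overlap_mid//; [|lra|lra].
  by have := @itail_le _ F Fi (x - y + h) (x + h) ltac:(lra); lra.
rewrite (overlap_nonpos _ x0 y0).
have -> : Num.max (- y) 0 = - y by clear -y0; piecewise.
set s := Num.min (- y) B.
have s0 : 0 <= s by rewrite /s; clear -y0 B0; piecewise.
have sy : s <= - y by rewrite /s; clear -y0 B0; piecewise.
have sB : s <= B by rewrite /s; clear -y0 B0; piecewise.
have := @itail_concave _ F Fi (x + s) (x - y) h ltac:(lra) h0.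
have := @itail_diff_le _ F Fi (x + h) (x + h + s) ltac:(lra) ltac:(lra).
have := @itail_diff_ge _ F Fi x (x + s) ltac:(lra).
have -> : x + h + s - (x + h) = s by lra.
have -> : x + s - x = s by lra.
have : s * Fb (x + B) <= s * Fb (x + s).
  by rewrite ler_wpM2l// tail_nonincreasing//; lra.
have -> : x + h + s = x + s + h by lra.
by lra.
Qed.

(** The window of length [h] grows by [L] while the walk moves by one step; the
    drift [b + c - a] leaves the margin [dl * tail F x]. *)
Lemma mean_window_drift B c dl e h x z : let b := truncated_neg_mean B in
  let L := 2 * (b + c) in
  0 <= B -> 0 <= c -> 0 <= h -> 0 <= x -> 0 <= z -> z <= x + c ->
  0 < dl -> e * (a + 2 * dl) = dl -> a + 3 * dl <= b + c ->
  Ex (fun y => if y <= z then overlap F (x + c) y else 0) <=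
    (a + dl) * Fb (x + c) ->
  Fb x <= (1 + e) * Fb (x + c + B) -> Fb (x + h) <= 2 * Fb (x + h + L) ->
  Ex (fun y => if y <= z then itail F (x + c - y + h) - itail F (x + c - y)
               else 0) <=
  itail F (x + h + L) - itail F x - dl * Fb x.
Proof.
move=> b L B0 c0 h0 x0 z0 zY dl0 eE bc ovE t2 t3.
have b0 : 0 <= b := truncated_neg_mean_ge0 B0.
have a0 := pos_mean_ge0 F.
have winE := mean_window_below B0 h0 z0 zY; rewrite -/b in winE.
apply: (le_trans winE); clear winE.
have L0 : 0 <= L by rewrite /L; clear -b0 c0; lra.
have xY : x <= x + c by rewrite lerDl.
have t4 : Fb (x + c) <= Fb x by apply: tail_nonincreasing.
have t5 : Fb (x + c + h) <= Fb (x + h).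
  by apply: tail_nonincreasing; rewrite lerD2r.
have t6 : Fb (x + c + B) <= Fb (x + c) by apply: tail_nonincreasing; rewrite lerDl.
have i1 : itail F (x + h + c) - itail F (x + h) <= (x + h + c - (x + h)) * Fb (x + h).
  by apply: (itail_diff_le Fi); rewrite ?addr_ge0// lerDl.
have i2 : (x + c - x) * Fb (x + c) <= itail F (x + c) - itail F x.
  exact: (itail_diff_ge Fi).
have i3 : (x + h + L - (x + h)) * Fb (x + h + L) <=
    itail F (x + h + L) - itail F (x + h).
  by apply: (itail_diff_ge Fi); rewrite lerDl.
rewrite addrC addKr in i2; rewrite (addrC (x + h) c) addrK (addrC c) in i1.
rewrite (addrC _ L) addrK (addrC L) in i3; rewrite (addrAC x h) in i1.
move: ovE t2 t3 t4 t5 t6 i1 i2 i3 (tail_ge0 F (x + c + B)).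
set V := Ex _; set p := Fb x; set q := Fb (x + c); set r := Fb (x + c + B).
set u := Fb (x + c + h); set v := Fb (x + h); set w := Fb (x + h + L).
rewrite /L; clear -c0 a0 dl0 b0 bc eE => ovE t2 t3 t4 t5 t6 i1 i2 i3 r0.
have k1 : b * u <= b * v by rewrite ler_wpM2l.
have adl : 0 <= a + dl by clear -a0 dl0; lra.
have adl2 : 0 <= a + 2 * dl by clear -a0 dl0; lra.
have bc0 : 0 <= b + c by exact: addr_ge0.
have k2 : (a + dl) * q <= (a + dl) * p by rewrite ler_wpM2l.
have k3 : (b + c) * v <= (b + c) * (2 * w) by rewrite ler_wpM2l.
have k4 : c * r <= c * q by rewrite ler_wpM2l.
have k5 : (a + 2 * dl) * p <= (a + 2 * dl) * ((1 + e) * r) by rewrite ler_wpM2l.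
have k6 : (a + 2 * dl) * ((1 + e) * r) = (a + 3 * dl) * r.
  have -> : (a + 2 * dl) * ((1 + e) * r) =
    (a + 2 * dl + e * (a + 2 * dl)) * r by ring.
  by rewrite eE; ring.
have k7 : (a + 3 * dl) * r <= (b + c) * r by rewrite ler_wpM2r.
by clear eE bc adl adl2 bc0; lra.
Qed.

(** For a walk with negative drift the maximum over [n] steps exceeds [x] with
    probability at most a constant times the integral of the tail over
    [x, x + L * n]. The right-hand side dominates by induction on [n]: beyond
    some [x0] the drift makes up for the big jumps, with a margin proportional
    to the tail, and this margin times [K] pays for landing below [x0], where
    the induction hypothesis is replaced by the trivial bound [1]. *)
Lemma max_tail_uniform c : 0 <= c -> Ex (fun y => y) < c ->
  exists K L, [/\ 0 <= K, 0 < L & forall n x, 0 <= x ->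
    max_tail F c n x <= K * (itail F (x + L * n%:R) - itail F x)].
Proof.
move=> c0 mc; have a0 := pos_mean_ge0 F.
(* A quarter of the drift: one quarter is lost when cutting off the negative
   part, two more in [mean_window_drift], and one remains as the margin. *)
pose dl := (c - Ex (fun y => y)) / 4.
have dl0 : 0 < dl by rewrite /dl; lra.
have [B B0 BP] := truncated_neg_mean_near dl0.
have b0 := truncated_neg_mean_ge0 B0.
have bc : a + 3 * dl <= truncated_neg_mean B + c by move: BP; rewrite /dl; lra.
move: dl dl0 bc {BP mc} => dl dl0 bc.
have adl : 0 < a + 2 * dl by lra.
pose e := dl / (a + 2 * dl).
have e0 : 0 < e by rewrite divr_gt0.
have eE : e * (a + 2 * dl) = dl by rewrite divfK// gt_eqF.
pose L := 2 * (truncated_neg_mean B + c).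
have L0 : 0 < L by rewrite /L; lra.
have [X1 X10 X1P] := long_tailed Fi Fpos Fconv (addr_ge0 c0 B0) e0.
have [X2 X20 X2P] := long_tailed Fi Fpos Fconv (ltW L0) ltr01.
have [X3 X30 X3P] := mean_overlap_below Fi Fconv dl0.
pose x0 := X1 + X2 + X3.
have x0_ge0 : 0 <= x0 by rewrite !addr_ge0.
have [X1x0 X2x0 X3x0] : [/\ X1 <= x0, X2 <= x0 & X3 <= x0].
  by rewrite /x0; clear -X10 X20 X30; split; lra.
(* [C] compares the tails at [x - x0] and [x], all the way down to [x0]. *)
have [X4 X40 X4P] := long_tailed Fi Fpos Fconv x0_ge0 ltr01.
have [C C0 CP] : exists2 C : R, 0 <= C &
    forall x, x0 <= x -> Fb (x - x0) <= C * Fb x.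
  have pV : 0 <= (Fb (x0 + X4))^-1 by rewrite invr_ge0 tail_ge0.
  exists (2 + (Fb (x0 + X4))^-1) => [|x x0x]; first exact: addr_ge0.
  rewrite mulrDl; have p0 := tail_ge0 F x.
  have [xX|xX] := leP (x0 + X4) x.
    have h1 : Fb (x - x0) <= (1 + 1) * Fb (x - x0 + x0).
      by apply: X4P; clear -xX; lra.
    rewrite subrK in h1; have h2 := mulr_ge0 pV p0.
    by clear -h1 h2; lra.
  rewrite (le_trans (tail_le1 F _))// -[leLHS]add0r lerD ?mulr_ge0//.
  by rewrite ler_pdivlMl// mulr1 tail_nonincreasing// ltW.
pose K := C / dl + (L * Fb (x0 + L))^-1.
have LF0 : 0 < L * Fb (x0 + L) by rewrite mulr_gt0.
have K1 : C <= K * dl.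
  by rewrite -ler_pdivrMr// lerDl invr_ge0 ltW.
have K2 : 1 <= K * (L * Fb (x0 + L)).
  by rewrite -ler_pdivrMr ?mul1r// lerDr divr_ge0// ltW.
have K0 : 0 <= K by rewrite addr_ge0 ?divr_ge0 ?invr_ge0// ltW.
move: K K1 K2 K0 => K K1 K2 K0.
exists K, L; split => //; elim=> [|n ih] x x_ge0.
  by rewrite max_tail0// mulr0 addr0 subrr mulr0.
have nS : x + L * n.+1%:R = x + L * n%:R + L by rewrite -natr1 mulrDr mulr1 addrA.
have h_ge0 : 0 <= L * n%:R by rewrite mulr_ge0// ltW.
rewrite nS; have [xx0|x0x] := ltP x x0.
  have /andP[_ /le_trans] := max_tail_itv F c n.+1 x; apply.
  apply: (le_trans K2); rewrite ler_wpM2l//.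
  have h1 : (x + L - x) * Fb (x + L) <= itail F (x + L) - itail F x.
    by apply: (itail_diff_ge Fi); rewrite lerDl ltW.
  have h2 : L * Fb (x0 + L) <= L * Fb (x + L).
    by rewrite ler_pM2l// tail_nonincreasing// lerD2r ltW.
  have h3 : itail F (x + L) <= itail F (x + L * n%:R + L).
    by apply: (itail_le Fi); rewrite lerD2r lerDl.
  by clear -h1 h2 h3; lra.
pose h := L * n%:R; rewrite -/h in ih h_ge0 *.
pose z := x + c - x0.
have z0 : 0 <= z by rewrite /z; clear -x0x c0; lra.
have zY : z <= x + c by rewrite /z gerBl.
pose win y := if y <= z then itail F (x + c - y + h) - itail F (x + c - y) else 0.
have wini : integrableR F win := integrable_window h_ge0 zY.
have drift : Ex win <= itail F (x + h + L) - itail F x - dl * Fb x.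
  apply: (mean_window_drift (e := e)) => //.
  - by apply: X3P => //; clear -X3x0 x0x c0; lra.
  - by rewrite -addrA; apply: X1P; exact: le_trans x0x.
  - by apply: X2P; clear -X2x0 x0x h_ge0; lra.
have rec : max_tail F c n.+1 x <= Fb z + K * Ex win.
  rewrite max_tailS// tailE -meanZ// -meanD; [|integrability..].
  apply: le_mean; [exact: integrable_max_tail|integrability|move=> y].
  rewrite /win; case: (leP y z) => yY.
    by rewrite add0r ih//; move: yY; rewrite /z; clear -x0_ge0; lra.
  by rewrite mulr0 addr0; case/andP: (max_tail_itv F c n (x + c - y)).
apply: (le_trans rec).
have t1 : Fb z <= C * Fb x.
  apply: le_trans (CP _ x0x); apply: tail_nonincreasing.
  by rewrite /z; clear -c0; lra.
have k1 : K * Ex win <= K * (itail F (x + h + L) - itail F x - dl * Fb x).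
  by rewrite ler_wpM2l.
have k2 : C * Fb x <= K * dl * Fb x by rewrite ler_wpM2r// tail_ge0.
by clear -t1 k1 k2; lra.
Qed.

End uniform_bound.

(** * Random index *)

Section random_index.
Context d {T : measurableType d} {R : realType} (P : probability T R).
Variables (tau : {RV P >-> nat}) (b : nat -> T -> bool).
Hypothesis mb : forall n, measurable_fun [set: T] (b n).
Hypothesis indep : forall n,
  P ([set w | b n w] `&` tau @^-1` [set n]) =
  (P [set w | b n w] * P (tau @^-1` [set n]))%E.

Let q n : R := fine (P [set w | b n w]).

Definition at_index w := b (tau w) w.

Lemma measurable_index_eq n : measurable_fun [set: T] (fun w => tau w == n).
Proof.
apply: (measurable_fun_bool true) => //.
rewrite setTI (_ : _ @^-1` _ = tau @^-1` [set n]).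
  by rewrite -[X in measurable X]setTI; exact: measurable_funPT.
by apply/seteqP; split => w /= /eqP.
Qed.

Lemma measurable_index_pred (Q : pred nat) :
  measurable_fun [set: T] (fun w => Q (tau w)).
Proof.
apply: (measurable_fun_bool true) => //.
rewrite setTI -[X in measurable X]setTI.
exact: (measurable_funPT tau measurableT [set n | Q n = true]).
Qed.

Lemma measurable_at_index : measurable_fun [set: T] at_index.
Proof.
apply: (measurable_fun_bool true) => //.
rewrite setTI (_ : _ @^-1` _ =
    \bigcup_n ([set w | b n w] `&` tau @^-1` [set n])).
  apply: bigcup_measurable => n _; apply: measurableI.
    by have /(_ measurableT [set true]) := @mb n; rewrite setTI; exact.
  by rewrite -[X in measurable X]setTI; exact: measurable_funPT.
apply/seteqP; split => w /=; rewrite /at_index; first by exists (tau w).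
by move=> [n _ [/= bw tw]]; rewrite tw.
Qed.

Let slice_mean n : mean P (fun w => if tau w == n then if b n w then 1 else 0 else 0)
  = q n * mean P (fun w => if tau w == n then 1 else 0).
Proof.
have mt := measurable_index_eq n.
have e1 : mean P (fun w => if tau w == n then 1 else 0) =
    fine (P (tau @^-1` [set n])).
  by rewrite mean_if//; congr (fine (P _)); apply/seteqP; split => w /= /eqP.
have mB : measurable [set w | b n w].
  by have /(_ measurableT [set true]) := @mb n; rewrite setTI; exact.
have mT : measurable (tau @^-1` [set n]).
  by rewrite -[X in measurable X]setTI; exact: measurable_funPT.
rewrite e1 /q -fineM ?fin_num_measure// -indep.
rewrite (@eq_mean _ _ _ _ _ (fun w => if b n w && (tau w == n) then 1 else 0)).
  rewrite mean_if; last exact: measurable_and.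
  congr (fine (P _)); apply/seteqP; split => w /=.
    by move=> /andP[bw /eqP tw]; split.
  by move=> [bw tw]; rewrite bw tw eqxx.
by move=> w; case: (b n w); case: (tau w == n).
Qed.

Let slice_sum (phi : nat -> T -> R) (Q : pred nat) N :
  (forall n, integrableR P (phi n)) ->
  mean P (fun w => if (tau w < N)%N && Q (tau w) then phi (tau w) w else 0) =
  \sum_(n < N) if Q n then mean P (fun w => if tau w == n then phi n w else 0)
               else 0.
Proof.
move=> phii.
pose F n w : R := if Q n then if tau w == n then phi n w else 0 else 0.
have Fi n : integrableR P (F n).
  rewrite /F; case: (Q n); last exact: integrableR_cst.
  have mt := measurable_index_eq n; have := phii n; move=> phin; integrability.
have [_ sumE] := mean_sum N Fi.
transitivity (mean P (fun w => \sum_(n < N) F n w)).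
  apply: eq_mean => w; case: ifP => [/andP[tN Qt]|tQ].
    rewrite (bigD1 (Ordinal tN))//= /F Qt eqxx big1 ?addr0// => i /eqP it.
    by case: ifP => // _; case: eqP => // ti; exfalso; apply: it; exact/val_inj.
  rewrite big1// => i _; rewrite /F; case: ifP => // Qi; case: eqP => // ti.
  by move: tQ; rewrite ti ltn_ord Qi.
rewrite sumE; apply: eq_bigr => n _; rewrite /F; case: (Q n) => //.
exact: mean_cst.
Qed.

(** Conditioning on the index turns bounds for each fixed number of summands
    into bounds for the random one. *)
Lemma mean_at_index_le (h : nat -> R) (Q : pred nat) N :
  (forall n, (n < N)%N -> Q n -> q n <= h n) ->
  mean P (fun w => if (tau w < N)%N && Q (tau w)
                   then if at_index w then 1 else 0 else 0) <=
  mean P (fun w => if (tau w < N)%N && Q (tau w) then h (tau w) else 0).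
Proof.
move=> qh.
rewrite (slice_sum (phi := fun n w => if b n w then 1 else 0)); last first.
  by move=> n; have := mb n => mbn; integrability.
rewrite (slice_sum (phi := fun n _ => h n)); last first.
  by move=> n; exact: integrableR_cst.
apply: ler_sum => n _; case: ifP => // Qn.
have mt := measurable_index_eq n.
rewrite slice_mean.
rewrite [leRHS](@eq_mean _ _ _ _ _ (fun w => h n * if tau w == n then 1 else 0)).
  rewrite meanZ; last by integrability.
  rewrite ler_wpM2r//; last exact: qh.
  by apply: mean_ge0 => w; case: ifP.
by move=> w; case: ifP; rewrite ?mulr1 ?mulr0.
Qed.

Lemma mean_at_index_ge (h : nat -> R) (Q : pred nat) N :
  (forall n, (n < N)%N -> Q n -> h n <= q n) ->
  mean P (fun w => if (tau w < N)%N && Q (tau w) then h (tau w) else 0) <=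
  mean P (fun w => if (tau w < N)%N && Q (tau w)
                   then if at_index w then 1 else 0 else 0).
Proof.
move=> qh.
rewrite (slice_sum (phi := fun n w => if b n w then 1 else 0)); last first.
  by move=> n; have := mb n => mbn; integrability.
rewrite (slice_sum (phi := fun n _ => h n)); last first.
  by move=> n; exact: integrableR_cst.
apply: ler_sum => n _; case: ifP => // Qn.
have mt := measurable_index_eq n.
rewrite slice_mean.
rewrite [leLHS](@eq_mean _ _ _ _ _ (fun w => h n * if tau w == n then 1 else 0)).
  rewrite meanZ; last by integrability.
  rewrite ler_wpM2r//; last exact: qh.
  by apply: mean_ge0 => w; case: ifP.
by move=> w; case: ifP; rewrite ?mulr1 ?mulr0.
Qed.

Hypothesis tau_int : integrableR P (fun w => (tau w)%:R).

Lemma integrable_index_if (Q : pred nat) (f g : T -> R) :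
  integrableR P f -> integrableR P g ->
  integrableR P (fun w => if Q (tau w) then f w else g w).
Proof. by move=> fi gi; apply: integrableR_if => //; exact: measurable_index_pred. Qed.

Lemma index_mean_tail e : 0 < e -> exists N : nat,
  mean P (fun w => if (N <= tau w)%N then (tau w)%:R else 0) <= e.
Proof.
move=> e0; have [B B0 Be] := mean_above_small tau_int e0.
exists (Num.truncn B).+1; apply: le_trans Be.
apply: le_mean.
- by apply: integrable_index_if => //; exact: integrableR_cst.
- by have := tau_int => ti; integrability.
move=> w; rewrite normr_nat; case: (leqP (Num.truncn B).+1 (tau w)) => tB.
  by rewrite ifT// (lt_le_trans (truncnS_gt B))// ler_nat.
by case: ifP.
Qed.

Lemma index_tail_small e N0 : 0 < e -> exists2 N : nat, (N0 <= N)%N &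
  mean P (fun w => if (N <= tau w)%N then 1 else 0) <= e.
Proof.
move=> e0; have [N Ne] := index_mean_tail e0.
exists (N0 + N).+1; first exact: leq_trans (leq_addr N N0) (leqnSn _).
apply: le_trans Ne; apply: le_mean.
- by apply: integrable_index_if; exact: integrableR_cst.
- by apply: integrable_index_if => //; exact: integrableR_cst.
move=> w; case: (leqP (N0 + N).+1 (tau w)) => tN; last by case: ifP.
rewrite ifT; last exact: leq_trans (leq_trans (leq_addl N0 N) (leqnSn _)) tN.
by rewrite ler1n; exact: leq_trans tN.
Qed.

(** Dominated convergence over the values of the index. *)
Lemma mean_at_index_tail_le (h : nat -> R) N :
  (forall n, 0 <= h n) -> integrableR P (fun w => h (tau w)) ->
  (forall n, (N <= n)%N -> q n <= h n) ->
  mean P (fun w => if (N <= tau w)%N then if at_index w then 1 else 0 else 0) <=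
  mean P (fun w => if (N <= tau w)%N then h (tau w) else 0).
Proof.
move=> h0 hi qh; apply/ler_addgt0Pl => e e0.
have [N' _ N'e] := index_tail_small 0 e0.
have ma := measurable_at_index.
have ai : integrableR P (fun w => if at_index w then 1 else 0) by integrability.
have zi : integrableR P (fun _ : T => 0) by exact: integrableR_cst.
have oi : integrableR P (fun _ : T => 1) by exact: integrableR_cst.
have i1 := integrable_index_if (fun n => (n < N')%N && (N <= n)%N) ai zi.
have i2 := integrable_index_if (fun n => (N' <= n)%N) oi zi.
have := @mean_at_index_le h (fun n => (N <= n)%N) N' (fun n _ => qh n).
have : mean P (fun w => if (tau w < N')%N && (N <= tau w)%N then h (tau w) else 0)
   <= mean P (fun w => if (N <= tau w)%N then h (tau w) else 0).
  apply: le_mean; [|exact: integrable_index_if|].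
    exact: (integrable_index_if (fun n => (n < N')%N && (N <= n)%N)).
  by move=> w; case: ltnP => //= _; case: ifP.
have : mean P (fun w => if (N <= tau w)%N then if at_index w then 1 else 0 else 0)
   <= mean P (fun w => if (N' <= tau w)%N then 1 else 0) +
   mean P (fun w => if (tau w < N')%N && (N <= tau w)%N
                   then if at_index w then 1 else 0 else 0).
  rewrite -(meanD i2 i1).
  apply: le_mean; [exact: integrable_index_if|exact: integrableRD|].
  move=> w; case: (ltnP (tau w) N') => _ /=; first by rewrite add0r.
  by rewrite addr0; case: ifP => // _; case: ifP.
lra.
Qed.

End random_index.

Section random_index_asymptotics.
Context d {T : measurableType d} {R : realType} (P : probability T R).
Variables (tau : {RV P >-> nat}) (Y : nat -> T -> R) (Fb : R -> R).
Hypothesis mY : forall n x, measurable [set w | x < Y n w].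
Hypothesis indepY : forall n x,
  P ([set w | x < Y n w] `&` tau @^-1` [set n]) =
  (P [set w | (x < Y n w)%R] * P (tau @^-1` [set n]))%E.
Hypothesis tau_int : integrableR P (fun w => (tau w)%:R).
Hypothesis Fb_ge0 : forall x, 0 <= Fb x.
Implicit Types (x e : R) (n N : nat).

Let q n x : R := fine (P [set w | x < Y n w]).
Let q_tau x : R := fine (P [set w | x < at_random_index Y tau w]).

Lemma measurable_exceed n x : measurable_fun [set: T] (fun w => x < Y n w).
Proof.
apply: (measurable_fun_bool true) => //.
by rewrite setTI; exact: mY.
Qed.

Let b x n w := x < Y n w.

Let mb x n : measurable_fun [set: T] (b x n) := measurable_exceed n x.

Let indepb x n := indepY n x.

Let ind_int x : integrableR P (fun w => if at_index tau (b x) w then 1 else 0).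
Proof. by have ma := measurable_at_index tau (mb x); integrability. Qed.

Let zero_int : integrableR P (fun=> 0) := integrableR_cst P 0.

Lemma q_tauE x : q_tau x = mean P (fun w => if at_index tau (b x) w then 1 else 0).
Proof. by rewrite mean_if//; exact: measurable_at_index. Qed.

Lemma eventually_lt (Q : nat -> R -> Prop) N :
  (forall n, exists2 X : R, 0 <= X & forall x, X <= x -> Q n x) ->
  exists2 X : R, 0 <= X & forall x, X <= x -> forall n, (n < N)%N -> Q n x.
Proof.
move=> QX; elim: N => [|N [X X0 XQ]]; first by exists 0.
have [X' X'0 X'Q] := QX N; exists (Num.max X X'); first by rewrite le_max X0.
move=> x; rewrite ge_max => /andP[Xx X'x] n.
by rewrite ltnS leq_eqVlt => /predU1P[->|/XQ]; [exact: X'Q|exact].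
Qed.

Lemma random_index_liminf :
  (forall n e, 0 < e -> exists2 X : R, 0 <= X &
    forall x, X <= x -> (n%:R - e) * Fb x <= q n x) ->
  forall e, 0 < e -> exists2 X : R, 0 <= X &
    forall x, X <= x -> (mean P (fun w => (tau w)%:R) - e) * Fb x <= q_tau x.
Proof.
move=> low e e0; have e20 : 0 < e / 2 by lra.
have [N Ne] := index_mean_tail tau_int e20.
have [X X0 XP] := eventually_lt N (fun n => low n _ e20).
exists X => // x Xx; rewrite q_tauE.
have := @mean_at_index_ge _ _ _ _ tau (b x) (mb x) (indepb x)
  (fun n => (n%:R - e / 2) * Fb x) predT N (fun n nN _ => XP x Xx n nN).
have i1 : integrableR P (fun w => if (tau w < N)%N && true
    then ((tau w)%:R - e / 2) * Fb x else 0).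
  apply: (integrable_index_if tau (fun n => (n < N)%N && true)) => //.
  under eq_fun do rewrite mulrC.
  by apply/integrableRZ/integrableRB => //; exact: integrableR_cst.
have i2 : integrableR P (fun w => if (N <= tau w)%N then (tau w)%:R else 0).
  exact: (integrable_index_if tau (fun n => (N <= n)%N)).
have : mean P (fun w => if (tau w < N)%N && true
    then if at_index tau (b x) w then 1 else 0 else 0) <=
  mean P (fun w => if at_index tau (b x) w then 1 else 0).
  apply: le_mean => //.
    exact: (integrable_index_if tau (fun n => (n < N)%N && true)).
  by move=> w; case: ((tau w < N)%N && true) => //; case: ifP.
have : Fb x * (mean P (fun w => (tau w)%:R) -
    mean P (fun w => if (N <= tau w)%N then (tau w)%:R else 0) - e / 2) <=
  mean P (fun w => if (tau w < N)%N && true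
    then ((tau w)%:R - e / 2) * Fb x else 0).
  have ci := integrableR_cst P (e / 2).
  rewrite -meanB// -[e / 2 in leLHS](mean_cst P) -meanB//; last exact: integrableRB.
  rewrite -meanZ; last by apply: integrableRB => //; exact: integrableRB.
  apply: le_mean => //.
    by apply/integrableRZ/integrableRB => //; exact: integrableRB.
  move=> w; case: (ltnP (tau w) N) => _ /=; first by rewrite subr0 mulrC.
  by rewrite subrr sub0r mulrN oppr_le0 mulr_ge0// ltW.
have := ler_wpM2l (Fb_ge0 x) Ne; rewrite mulrC.
set A := mean _ _; set B := mean _ _; set C := mean _ _; set D := mean _ _.
by move=> h1 h2 h3 h4; lra.
Qed.

Lemma random_index_limsup :
  (forall n e, 0 < e -> exists2 X : R, 0 <= X &
    forall x, X <= x -> q n x <= (n%:R + e) * Fb x) ->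
  (forall e, 0 < e -> exists N, exists2 X : R, 0 <= X & forall x, X <= x ->
    mean P (fun w => if (N <= tau w)%N
      then if at_index tau (fun n w => x < Y n w) w then 1 else 0 else 0)
    <= e * Fb x) ->
  forall e, 0 < e -> exists2 X : R, 0 <= X &
    forall x, X <= x -> q_tau x <= (mean P (fun w => (tau w)%:R) + e) * Fb x.
Proof.
move=> upp rest e e0; have e20 : 0 < e / 2 by lra.
have [N [X1 X10 X1P]] := rest _ e20.
have [X2 X20 X2P] := eventually_lt N (fun n => upp n _ e20).
exists (Num.max X1 X2) => [|x]; first by rewrite le_max X10.
rewrite ge_max => /andP[X1x X2x]; rewrite q_tauE.
have := @mean_at_index_le _ _ _ _ tau (b x) (mb x) (indepb x)
  (fun n => (n%:R + e / 2) * Fb x) predT N (fun n nN _ => X2P x X2x n nN).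
have i1 : integrableR P (fun w => Fb x * ((tau w)%:R + e / 2)).
  by apply/integrableRZ/integrableRD => //; exact: integrableR_cst.
have i2 : integrableR P (fun w => if (tau w < N)%N && true
    then if at_index tau (b x) w then 1 else 0 else 0).
  exact: (integrable_index_if tau (fun n => (n < N)%N && true)).
have i3 : integrableR P (fun w => if (N <= tau w)%N
    then if at_index tau (b x) w then 1 else 0 else 0).
  exact: (integrable_index_if tau (fun n => (N <= n)%N)).
have : mean P (fun w => if at_index tau (b x) w then 1 else 0) <=
  mean P (fun w => if (tau w < N)%N && true
    then if at_index tau (b x) w then 1 else 0 else 0) +
  mean P (fun w => if (N <= tau w)%N
    then if at_index tau (b x) w then 1 else 0 else 0).
  rewrite -meanD//; apply: le_mean => //; first exact: integrableRD.
  by move=> w; case: (ltnP (tau w) N) => _ /=; rewrite ?addr0 ?add0r.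
have : mean P (fun w => if (tau w < N)%N && true
    then ((tau w)%:R + e / 2) * Fb x else 0) <=
  Fb x * (mean P (fun w => (tau w)%:R) + e / 2).
  have ci := integrableR_cst P (e / 2).
  rewrite -[e / 2 in leRHS](mean_cst P) -meanD// -meanZ; last exact: integrableRD.
  apply: le_mean => //.
    under eq_fun do rewrite mulrC.
    exact: (integrable_index_if tau (fun n => (n < N)%N && true)).
  move=> w; case: ifP => _; first by rewrite mulrC.
  by rewrite mulr_ge0// addr_ge0// ltW.
have := X1P x X1x.
rewrite -/(b x).
set A := mean _ _; set B := mean _ _; set C := mean _ _; set D := mean _ _.
by move=> h1 h2 h3 h4; lra.
Qed.

End random_index_asymptotics.

Section overlap_comparison.
Context {R : realType} (F : probability R R).
Implicit Types (x y c e : R).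

Notation Ex := (mean F).
Notation Fb := (tail F).
Notation a := (pos_mean F).

Hypothesis Fi : integrableR F (fun y => y).

Lemma overlap_nondecreasing x y y' : y <= y' -> overlap F x y <= overlap F x y'.
Proof. by move=> yy'; rewrite lerD2l lerN2 itail_le//; piecewise. Qed.

Let jump c x (j : nat) := overlap F x (c * j.+1%:R) - overlap F x (c * j%:R).

Let jump_ge0 c x j : 0 < c -> 0 <= jump c x j.
Proof.
by move=> c0; rewrite subr_ge0 overlap_nondecreasing// ler_pM2l// ler_nat.
Qed.

Let sum_jump c x n : 0 <= x ->
  \sum_(j < n) jump c x j = overlap F x (c * n%:R).
Proof.
move=> x0; elim: n => [|n ih].
  by rewrite big_ord0 mulr0 overlap_nonpos.
by rewrite big_ord_recr/= ih /jump addrC subrK.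
Qed.

(** Over the grid points below [y] the increments add up to the overlap of the
    last of them. *)
Lemma sum_jump_below c x y n : 0 < c -> 0 <= x ->
  \sum_(j < n) jump c x j * (if c * j.+1%:R < y then 1 else 0) <= overlap F x y.
Proof.
move=> c0 x0.
suff [] : \sum_(j < n) jump c x j * (if c * j.+1%:R < y then 1 else 0) <= overlap F x y /\
  \sum_(j < n) jump c x j * (if c * j.+1%:R < y then 1 else 0) <=
    overlap F x (c * n%:R) by [].
elim: n => [|n [ih1 ih2]].
  by rewrite big_ord0 overlap_ge0// overlap_ge0.
rewrite big_ord_recr/=.
have mono : overlap F x (c * n%:R) <= overlap F x (c * n.+1%:R).
  by rewrite -subr_ge0; exact: jump_ge0.
case: ifP => cy; rewrite ?mulr1 ?mulr0 ?addr0; last first.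
  by split => //; exact: le_trans mono.
have le2 : \sum_(j < n) jump c x j * (if c * j.+1%:R < y then 1 else 0) + jump c x n
    <= overlap F x (c * n.+1%:R).
  by rewrite /jump in ih2 *; lra.
by split => //; apply: (le_trans le2); rewrite overlap_nondecreasing// ltW.
Qed.

Context d {T : measurableType d} (P : probability T R) (tau : {RV P >-> nat}).

(** Summation by parts: the mean of the overlap is an integral of the tail of
    the jump, so a lighter tail gives a smaller mean. *)
Lemma mean_overlap_lighter c e x N : 0 < c -> 0 <= x -> 0 <= e ->
  (forall j : nat, mean P (fun w => if (j < tau w)%N && (N <= tau w)%N then 1 else 0)
     <= e * Fb (c * j.+1%:R)) ->
  mean P (fun w => if (N <= tau w)%N then
      if c * (tau w)%:R <= x then overlap F x (c * (tau w)%:R) else 0 else 0)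
  <= e * Ex (overlap F x).
Proof.
move=> c0 x0 e0 light.
pose J := Num.truncn (x / c).
pose ind j w : R := if (j < tau w)%N && (N <= tau w)%N then 1 else 0.
have indi j : integrableR P (ind j).
  by apply: (integrable_index_if tau (fun n => (j < n)%N && (N <= n)%N));
    exact: integrableR_cst.
have [si sE] := mean_sum J (fun j => integrableRZ (jump c x j) (indi j)).
have oi := integrable_overlap Fi x0.
pose ind' j y : R := if c * j.+1%:R < y then 1 else 0.
have indi' j : integrableR F (ind' j) by rewrite /ind'; integrability.
have [si' sE'] := mean_sum J (fun j => integrableRZ (jump c x j) (indi' j)).
have mo : measurable_fun [set: T] (fun w => if (N <= tau w)%N then
      if c * (tau w)%:R <= x then overlap F x (c * (tau w)%:R) else 0 else 0).
  pose g n : R := if (N <= n)%N then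
    if c * n%:R <= x then overlap F x (c * n%:R) else 0 else 0.
  by apply: (@measurableT_comp _ _ _ _ _ _ g).
apply: (@le_trans _ _ (mean P (fun w => \sum_(j < J) jump c x j * ind j w))).
  apply: le_mean => //.
    apply: (@integrableR_bounded _ _ _ _ _ (itail F x) mo) => w.
    case: ifP => _; last by rewrite normr0 itail_ge0.
    case: ifP => _; last by rewrite normr0 itail_ge0.
    rewrite ger0_norm ?overlap_ge0// /overlap gerBl itail_ge0//.
    by rewrite le_max lexx orbT.
  move=> w; case: ifP => Nt; last first.
    by apply: sumr_ge0 => j _; rewrite mulr_ge0 ?jump_ge0// /ind; case: ifP.
  case: ifP => tx; last first.
    by apply: sumr_ge0 => j _; rewrite mulr_ge0 ?jump_ge0// /ind; case: ifP.
  have tJ : (tau w <= J)%N.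
    rewrite /J truncn_ge_nat; first by rewrite ler_pdivlMr// mulrC.
    by rewrite divr_ge0// ltW.
  have -> : overlap F x (c * (tau w)%:R) = \sum_(j < tau w) jump c x j.
    by rewrite sum_jump.
  rewrite (big_ord_widen _ _ tJ) big_mkcond/=; apply: ler_sum => j _.
  by rewrite /ind Nt andbT; case: ifP => _; rewrite ?mulr1 ?mulr0.
rewrite sE -(meanZ e oi); apply: (@le_trans _ _
    (mean F (fun y => e * \sum_(j < J) jump c x j * ind' j y))); last first.
  apply: le_mean; [exact: integrableRZ|exact: integrableRZ|move=> y].
  by rewrite ler_wpM2l// sum_jump_below.
rewrite meanZ// sE' mulr_sumr; apply: ler_sum => j _.
rewrite !meanZ// mulrCA ler_wpM2l ?jump_ge0//.
by rewrite -tailE; exact: light.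
Qed.

Hypothesis tau_int : integrableR P (fun w => (tau w)%:R).
Hypothesis Fpos : right_unbounded F.
Hypothesis Fconv : forall e, 0 < e -> exists2 X : R, 0 <= X &
  forall x, X <= x -> Ex (overlap F x) <= (2 * a + e) * Fb x.

(** Far out the index is lighter by assumption; before that there are only
    finitely many grid points, and [N] is taken so large that the index seldom
    reaches it. *)
Lemma index_tail_lighter c e : 0 < c ->
  (forall e, 0 < e -> exists2 X : R, 0 <= X &
    forall x, X <= x -> fine (P [set w | x < c * (tau w)%:R]) <= e * Fb x) ->
  0 < e -> exists N, forall j : nat,
    mean P (fun w => if (j < tau w)%N && (N <= tau w)%N then 1 else 0)
    <= e * Fb (c * j.+1%:R).
Proof.
move=> c0 light e0; have e20 : 0 < e / 2 by lra.
have [X1 X10 X1P] := light _ e20.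
have [X2 X20 X2P] := long_tailed Fi Fpos Fconv (ltW c0) ltr01.
pose j0 := (Num.truncn ((X1 + X2) / c)).+1.
have j0P : X1 + X2 <= c * j0%:R.
  by rewrite -ler_pdivrMl// mulrC ltW// truncnS_gt.
have eF : 0 < e * Fb (c * j0%:R) by rewrite mulr_gt0.
have [N _ NP] := index_tail_small tau_int 0 eF.
have one := integrableR_cst P (1 : R).
have zero := integrableR_cst P (0 : R).
have ind (Q : pred nat) : integrableR P (fun w => if Q (tau w) then 1 else 0).
  exact: (integrable_index_if tau Q).
exists N => j; have [jj0|j0j] := ltnP j j0.
  apply: (@le_trans _ _ (e * Fb (c * j0%:R))).
    apply: le_trans NP; apply: le_mean.
    - exact: (ind (fun n => (j < n)%N && (N <= n)%N)).
    - exact: (ind (fun n => (N <= n)%N)).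
    - by move=> w; case: (N <= tau w)%N; rewrite ?andbF ?andbT//; case: ifP.
  by rewrite ler_pM2l// tail_nonincreasing// ler_pM2l// ler_nat.
have jX : X1 + X2 <= c * j%:R.
  by apply: (le_trans j0P); rewrite ler_pM2l// ler_nat.
have h1 : fine (P [set w | c * j%:R < c * (tau w)%:R]) <= e / 2 * Fb (c * j%:R).
  by apply: X1P; lra.
have h2 : Fb (c * j%:R) <= (1 + 1) * Fb (c * j%:R + c) by apply: X2P; lra.
have -> : c * j.+1%:R = c * j%:R + c by rewrite -natr1 mulrDr mulr1.
apply: (@le_trans _ _ (e / 2 * Fb (c * j%:R))).
  apply: le_trans h1.
  rewrite -mean_if; last first.
    exact: (measurable_index_pred tau (fun n => c * j%:R < c * n%:R)).
  apply: le_mean.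
  - exact: (ind (fun n => (j < n)%N && (N <= n)%N)).
  - exact: (ind (fun n => c * j%:R < c * n%:R)).
  - by move=> w; rewrite ltr_pM2l// ltr_nat; case: (j < tau w)%N => //=; case: ifP.
have := ler_wpM2l (ltW e20) h2; lra.
Qed.

End overlap_comparison.

(** * The asymptotics *)

Section randomly_stopped.
Context d {T : measurableType d} {R : realType} (P : probability T R).
Variables (xi : {RV P >-> R}) (xis : nat -> {RV P >-> R}) (tau : {RV P >-> nat}).
Hypothesis xis_indep : mutually_independent P xis.
Hypothesis xis_distr : forall n, identically_distributed P (xis n) xi.
Hypothesis xi_Sstar : class_Sstar (distribution P xi).
Hypothesis tau_mean : ('E_P[fun w => (tau w)%:R] < +oo)%E.
Hypothesis tau_indep : independent_of_sequence P tau xis.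
Implicit Types (x e c : R) (n N : nat).

Let F : probability R R := distribution P xi.
Let Fb := tail F.
Let S := partial_sum xis.
Let M := partial_max xis.
Let m : R := mean P (fun w => (tau w)%:R).

Let Fi : integrableR F (fun y => y).
Proof. by have [] := xi_Sstar. Qed.

Let Fpos : right_unbounded F.
Proof. by have [] := xi_Sstar. Qed.

Let Fconv : forall e, 0 < e -> exists2 X : R, 0 <= X &
  forall x, X <= x -> mean F (overlap F x) <= (2 * pos_mean F + e) * Fb x.
Proof. exact: class_Sstar_overlap. Qed.

Let law n B : measurable B -> distribution P (xis n) B = F B.
Proof. exact: xis_distr. Qed.

Lemma mean_index :
  ('E_P[fun w => (tau w)%:R] = \int[P]_w ((tau w)%:R : R)%:E)%E.
Proof. by rewrite unlock. Qed.

Let tau_int : integrableR P (fun w => (tau w)%:R).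
Proof.
apply/integrableP; split.
  apply/measurable_EFinP.
  by apply: (@measurableT_comp _ _ _ _ _ _ (fun n : nat => n%:R : R)).
have := tau_mean; rewrite mean_index; apply: le_lt_trans.
by under eq_integral do rewrite /= normr_nat.
Qed.

Let EtauE : fine 'E_P[fun w => (tau w)%:R] = m.
Proof. by rewrite mean_index. Qed.

Let G := \bigcup_n preimage_set_system [set: T] (xis n) measurable.

Let xis_sigma n :
  measurable_fun [set: g_sigma_algebraType G] (xis n : g_sigma_algebraType G -> R).
Proof.
move=> _ B mB; rewrite setTI; apply: sub_sigma_algebra.
by exists n => //; exists B; rewrite ?setTI.
Qed.

Let sum_event n x : measurable [set w | x < S n w].
Proof. exact/measurable_lt_event/measurable_partial_sum. Qed.

Let max_event n x : measurable [set w | x < M n w].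
Proof. exact: measurable_partial_max_event. Qed.

Let sum_indep n x :
  P ([set w | x < S n w] `&` tau @^-1` [set n]) =
  (P [set w | (x < S n w)%R] * P (tau @^-1` [set n]))%E.
Proof.
apply: tau_indep.
apply: (@measurable_lt_event _ (g_sigma_algebraType G)).
exact: measurable_partial_sum.
Qed.

Let max_indep n x :
  P ([set w | x < M n w] `&` tau @^-1` [set n]) =
  (P [set w | (x < M n w)%R] * P (tau @^-1` [set n]))%E.
Proof.
apply: tau_indep.
exact: (@measurable_partial_max_event _ (g_sigma_algebraType G)).
Qed.

Let Fb_ge0 x : 0 <= Fb x := tail_ge0 F x.

Lemma random_sum_liminf e : 0 < e -> exists2 X : R, 0 <= X & forall x, X <= x ->
  (m - e) * Fb x <= fine (P [set w | x < at_random_index S tau w]).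
Proof.
apply: (random_index_liminf sum_event sum_indep tau_int Fb_ge0) => n e' e'0.
have [X X0 XP] := sum_tail_lower Fi Fpos Fconv n e'0.
exists X => // x Xx; rewrite (probability_sum xis_indep law); exact: XP.
Qed.

(** What dominated convergence over the index has to supply: the large values of
    the index contribute little, uniformly in the level. *)
Definition negligible_late_maxima :=
  forall e, 0 < e -> exists N, exists2 X : R, 0 <= X & forall x, X <= x ->
    mean P (fun w => if (N <= tau w)%N
      then if at_index tau (fun n w => x < M n w) w then 1 else 0 else 0)
    <= e * Fb x.

Lemma random_max_limsup : negligible_late_maxima ->
  forall e, 0 < e -> exists2 X : R, 0 <= X & forall x, X <= x ->
  fine (P [set w | x < at_random_index M tau w]) <= (m + e) * Fb x.
Proof.
move=> late; apply: (random_index_limsup max_event max_indep tau_int Fb_ge0 _ late).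
move=> n e' e'0.
have [X X0 XP] := max_tail_upper Fi Fpos Fconv n e'0.
exists X => // x Xx; rewrite (probability_partial_max xis_indep law); exact: XP.
Qed.

Let random_event (Y : nat -> T -> R) x : (forall n y, measurable [set w | y < Y n w]) ->
  measurable [set w | x < at_random_index Y tau w].
Proof.
move=> mY; have := measurable_at_index tau (fun n => measurable_exceed mY n x).
by move=> /(_ measurableT [set true]); rewrite setTI; exact.
Qed.

Lemma asymptotics_of_late_maxima :
  negligible_late_maxima -> random_sum_tail_asymptotics P xi xis tau.
Proof.
move=> late.
have SM w : at_random_index S tau w <= at_random_index M tau w.
  by rewrite /at_random_index /M /partial_max; apply: (le_bigmax_cond _ _ (j := ord_max)).
have SMP x : fine (P [set w | x < at_random_index S tau w]) <=
             fine (P [set w | x < at_random_index M tau w]).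
  apply: le_probability; [exact: random_event|exact: random_event|move=> w /=].
  by move/lt_le_trans; apply.
suff ratio (p : R -> R) :
    (forall e, 0 < e -> exists2 X : R, 0 <= X & forall x, X <= x ->
      (m - e) * Fb x <= p x <= (m + e) * Fb x) ->
    p x / Fb x @[x --> +oo] --> m.
  rewrite /random_sum_tail_asymptotics EtauE /tail_ratio_cvg.
  split; apply: ratio => e e0.
    have [X1 X10 X1P] := random_sum_liminf e0.
    have [X2 X20 X2P] := random_max_limsup late e0.
    exists (Num.max X1 X2) => [|x]; first by rewrite le_max X10.
    rewrite ge_max => /andP[X1x X2x]; rewrite X1P//=.
    exact: le_trans (SMP x) (X2P x X2x).
  have [X1 X10 X1P] := random_sum_liminf e0.
  have [X2 X20 X2P] := random_max_limsup late e0.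
  exists (Num.max X1 X2) => [|x]; first by rewrite le_max X10.
  rewrite ge_max => /andP[X1x X2x]; rewrite X2P// andbT.
  exact: le_trans (X1P x X1x) (SMP x).
move=> pP; apply/cvgrPdist_le => e e0; have [X X0 XP] := pP e e0.
exists X; split; first exact: num_real.
move=> x /ltW Xx; have /andP[h1 h2] := XP x Xx; have p0 : 0 < Fb x := Fpos x.
rewrite distrC ler_distl.
by rewrite ler_pdivlMr// ler_pdivrMr// h1 h2.
Qed.

(** The window bound is at most [K * L * n * tail F x]; so [K * L * tau]
    dominates. *)
Lemma late_maxima_neg_drift : mean F (fun y => y) < 0 -> negligible_late_maxima.
Proof.
move=> m0 e e0.
have [K [L [K0 L0 KP]]] := max_tail_uniform Fi Fpos Fconv (lexx 0) m0.
have KL1 : 0 < K * L + 1 by rewrite ltr_wpDl// mulr_ge0// ltW.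
have e'0 : 0 < e / (K * L + 1) by rewrite divr_gt0.
have [N NP] := index_mean_tail tau_int e'0.
exists N, 0 => // x x0.
pose h n : R := K * L * Fb x * n%:R.
have h0 n : 0 <= h n by rewrite /h !mulr_ge0// ltW.
have hi : integrableR P (fun w => h (tau w)) by exact: integrableRZ.
apply: le_trans (mean_at_index_tail_le (fun n => measurable_exceed max_event n x)
  (fun n => max_indep n x) tau_int h0 hi _) _.
  move=> n _; rewrite (probability_partial_max xis_indep law).
  apply: (le_trans (KP n x x0)); rewrite /h -!mulrA ler_wpM2l//.
  have Ln0 : 0 <= L * n%:R by rewrite mulr_ge0// ltW.
  have : itail F (x + L * n%:R) - itail F x <= (x + L * n%:R - x) * Fb x.
    by apply: (itail_diff_le Fi); rewrite ?lerDl.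
  by rewrite [x + _]addrC addrK -mulrA (mulrC (Fb x)).
rewrite (@eq_mean _ _ _ _ _
    (fun w => K * L * Fb x * if (N <= tau w)%N then (tau w)%:R else 0)).
  rewrite meanZ; last first.
    apply: (integrable_index_if tau (fun n => (N <= n)%N)) => //.
    exact: integrableR_cst.
  have : K * L * (e / (K * L + 1)) <= e.
    rewrite mulrA ler_pdivrMr// mulrC ler_pM2l//; lra.
  have KLF : 0 <= K * L * Fb x by rewrite !mulr_ge0// ltW.
  move=> /(ler_wpM2r (Fb_ge0 x)); apply: le_trans.
  by rewrite [leRHS]mulrAC ler_wpM2l.
by move=> w; rewrite /h; case: ifP; rewrite ?mulr0.
Qed.

(** The walk with increments lowered by [c] has negative drift, and is asked to
    exceed [x - c * n]. While [c * n <= x] the window bound at that level is a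
    multiple of [overlap F x (c * n)], so that the sum over [n] is the convolution
    of the tails of the increments and of [c * tau], which is negligible because
    the latter is. The event [x < c * tau] is negligible by assumption. *)
Lemma late_maxima_light_index c : 0 <= mean F (fun y => y) ->
  mean F (fun y => y) < c ->
  (forall e, 0 < e -> exists2 X : R, 0 <= X &
    forall x, X <= x -> fine (P [set w | x < c * (tau w)%:R]) <= e * Fb x) ->
  negligible_late_maxima.
Proof.
move=> m0 mc light e e0.
have c0 : 0 < c by exact: le_lt_trans m0 mc.
have [K [L [K0 L0 KP]]] := max_tail_uniform Fi Fpos Fconv (ltW c0) mc.
pose L' := Num.max L c.
pose k := K * (L' / c).
have k0 : 0 <= k by rewrite mulr_ge0// divr_ge0 ?ltW// lt_max c0 orbT.
have a0 := pos_mean_ge0 F.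
have den0 : 0 < k * (2 * pos_mean F + 1) + 1.
  by rewrite ltr_wpDl// mulr_ge0//; lra.
pose e' := e / 2 / (k * (2 * pos_mean F + 1) + 1).
have e20 : 0 < e / 2 by lra.
have e'0 : 0 < e' by rewrite divr_gt0.
have [N NP] := index_tail_lighter Fi tau_int Fpos Fconv c0 light e'0.
have [X1 X10 X1P] := light _ e20.
have [X2 X20 X2P] := Fconv ltr01.
exists N, (Num.max X1 X2) => [|x]; first by rewrite le_max X10.
rewrite ge_max => /andP[X1x X2x]; have x0 : 0 <= x by exact: le_trans X1x.
pose h n : R := if c * n%:R <= x then k * overlap F x (c * n%:R) else 1.
have h0 n : 0 <= h n.
  by rewrite /h; case: ifP => // _; rewrite mulr_ge0// overlap_ge0.
have ov_le y : overlap F x y <= itail F x.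
  by rewrite /overlap gerBl itail_ge0// le_max lexx orbT.
have mh : measurable_fun [set: T] (fun w => h (tau w)).
  exact: (@measurableT_comp _ _ _ _ _ _ h).
have hi : integrableR P (fun w => h (tau w)).
  apply: (@integrableR_bounded _ _ _ _ _ (k * itail F x + 1) mh) => w.
  rewrite ger0_norm// /h; case: ifP => _.
    by rewrite (le_trans (ler_wpM2l k0 (ov_le _)))// lerDl.
  by rewrite lerDr mulr_ge0// itail_ge0.
apply: le_trans (mean_at_index_tail_le (fun n => measurable_exceed max_event n x)
  (fun n => max_indep n x) tau_int h0 hi _) _.
  move=> n _; rewrite /h; case: ifP => [cx|_]; last first.
    by rewrite (probability_partial_max xis_indep law);
      case/andP: (max_tail_itv F 0 n x).
  apply: (le_trans (probability_le_max_tail xis_indep law n x (ltW c0))).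
  have z0 : 0 <= x - c * n%:R by rewrite subr_ge0.
  apply: (le_trans (KP n _ z0)); rewrite /k -mulrA ler_wpM2l//.
  rewrite overlap_mid//; last by rewrite mulr_ge0// ltW.
  have [n0|n0] := posnP n.
    have nR : n%:R = 0 :> R by rewrite n0.
    by rewrite nR !mulr0 addr0 subr0 !subrr mulr0.
  have n0R : 0 < n%:R :> R by rewrite ltr0n.
  (* From windows of length [L * n] to windows of length [c * n], which end
     at [x]. *)
  have := @itail_star _ F Fi (x - c * n%:R) (c * n%:R) (L' * n%:R)
    (mulr_gt0 c0 n0R).
  rewrite ler_pM2r// le_max lexx orbT subrK => /(_ isT).
  rewrite -mulf_div divff ?mulr1 ?gt_eqF//; apply: le_trans.
  by rewrite lerD2r itail_le// lerD2l ler_pM2r// le_max lexx.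
pose far w : R := if x < c * (tau w)%:R then 1 else 0.
pose near w : R := if (N <= tau w)%N then
  if c * (tau w)%:R <= x then overlap F x (c * (tau w)%:R) else 0 else 0.
have fari : integrableR P far.
  apply: (integrable_index_if tau (fun n => x < c * n%:R)); exact: integrableR_cst.
have neari : integrableR P near.
  pose g n : R := if (N <= n)%N then
    if c * n%:R <= x then overlap F x (c * n%:R) else 0 else 0.
  apply: (@integrableR_bounded _ _ _ _ _ (itail F x)) => [|w].
    by apply: (@measurableT_comp _ _ _ _ _ _ g).
  rewrite /near; case: ifP => _; last by rewrite normr0 itail_ge0.
  case: ifP => _; last by rewrite normr0 itail_ge0.
  by rewrite ger0_norm ?overlap_ge0.
apply: (@le_trans _ _ (mean P far + k * mean P near)).
  rewrite -meanZ// -meanD//; last exact: integrableRZ.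
  apply: le_mean.
  - apply: (integrable_index_if tau (fun n => (N <= n)%N)) => //.
    exact: integrableR_cst.
  - by apply: integrableRD => //; exact: integrableRZ.
  move=> w; rewrite /far /near /h; case: ifP => _; last first.
    by rewrite mulr0 addr0; case: ifP.
  by case: (leP (c * (tau w)%:R) x) => _; rewrite ?add0r// mulr0 addr0.
have farE : mean P far <= e / 2 * Fb x.
  rewrite mean_if; first exact: X1P.
  exact: (measurable_index_pred tau (fun n => x < c * n%:R)).
have nearE : mean P near <= e' * mean F (overlap F x).
  by apply: mean_overlap_lighter => //; exact: ltW.
have conv := X2P x X2x.
have : k * mean P near <= e / 2 * Fb x.
  apply: (@le_trans _ _ (k * (e' * ((2 * pos_mean F + 1) * Fb x)))).
    by rewrite ler_wpM2l// (le_trans nearE)// ler_wpM2l// ltW.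
  have -> : k * (e' * ((2 * pos_mean F + 1) * Fb x)) =
    e' * (k * (2 * pos_mean F + 1)) * Fb x by ring.
  rewrite ler_wpM2r// /e' mulrAC ler_pdivrMr// ler_pM2l// lerDl//.
lra.
Qed.

End randomly_stopped.

Theorem theorem1 (d : measure_display) (T : measurableType d) (R : realType)
    (P : probability T R)
    (xi : {RV P >-> R}) (xis : nat -> {RV P >-> R}) (tau : {RV P >-> nat})
    (xis_indep : mutually_independent P xis)
    (xis_distr : forall n, identically_distributed P (xis n) xi)
    (xi_mean : P.-integrable [set: T] (fun w => (xi w)%:E))
    (xi_Sstar : class_Sstar (distribution P xi))
    (tau_mean : ('E_P[fun w => (tau w)%:R] < +oo)%E)
    (tau_indep : independent_of_sequence P tau xis) :
  (('E_P[xi] < 0)%E -> random_sum_tail_asymptotics P xi xis tau) /\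
  ((0 <= 'E_P[xi])%E ->
   (exists c : R, ('E_P[xi] < c%:E)%E /\
      (fun x : R => fine (P [set w | x < c * (tau w)%:R])) =o_ (pinfty_nbhs R)
        tail (distribution P xi)) ->
   random_sum_tail_asymptotics P xi xis tau).
Proof.
have Fi : integrableR (distribution P xi) (fun y => y) by have [] := xi_Sstar.
have EE : ('E_P[xi] = (mean (distribution P xi) (fun y => y))%:E)%E.
  by rewrite EFin_mean// integral_distribution// expectation_def.
rewrite EE !lte_fin !lee_fin; split => [m0|m0 [c [mc light]]].
  by apply: asymptotics_of_late_maxima => //; exact: late_maxima_neg_drift.
rewrite lte_fin in mc.
apply: asymptotics_of_late_maxima => //.
apply: (late_maxima_light_index _ _ _ _ _ m0 mc) => // e e0.
have [X [_ XP]] := (eqoP _ _ _).1 light e e0.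
exists (Num.max 0 (X + 1)) => [|x]; first by rewrite le_max lexx.
rewrite ge_max => /andP[_ Xx]; have /XP/= : X < x by lra.
rewrite [X in _ <= _ * X]ger0_norm ?tail_ge0//.
exact: le_trans (ler_norm _).
Qed.
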